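(* For every integer $\omega$ and every $\mathsf{MSO}_1$-sentence $\psi$ on graphs, there is a proof labeling scheme $(\mathsf{P},\mathsf{V})$ of size $O(\log n)$ for the class of connected graphs that have locally verifiable treewidth at most $\omega$ and satisfy $\psi$.
   Context: An $\mathsf{MSO}_1$-sentence on graphs is a monadic second-order sentence (quantifiers over vertices and over sets of vertices) over the vocabulary consisting of one binary predicate $\mathsf{edge}$, interpreted on the structure with universe $V(G)$ and $\mathsf{edge}(u,v)$ iff $uv\in E(G)$. An elimination tree of a connected graph $G$ is a rooted tree $F$ with $V(F)=V(G)$ such that for every edge $uv$ of $G$ one endpoint is an ancestor of the other in $F$; with $F_v$ the subtree rooted at $v$ and $\mathsf{str}(v)$ the set of $v$ and all strict ancestors of $v$ with a neighbour in $V(F_v)$, the width of $F$ is $\max_v|\mathsf{str}(v)|-1$. An oriented path system over $G$ is a set of oriented paths each obtained by orienting a path of $G$; the congestion of a vertex $v$ is the number of its paths having $v$ as starting or internal vertex, and the congestion of the system is the maximum over vertices; it witnesses $F$ if for every non-root $v$ with parent $\mathsf{p}(v)$, either $v\mathsf{p}(v)\in E(G)$ or the system contains a path oriented from $v$ to $\mathsf{p}(v)$. A graph has locally verifiable treewidth at most $k$ if each component has an elimination tree of width at most $k$ and a witnessing oriented path system of congestion at most $k$. Proof labeling scheme: vertices have unique identifiers in $\{1,\dots,n\}$; the prover assigns binary labels; the verifier at $v$ sees only $\mathsf{id}(v)$ and $(\mathsf{id}(w),\varphi(w))$ for $w\in N[v]$ and outputs Yes/No; completeness: on graphs in the class the prover's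 labels make all vertices accept; soundness: on graphs outside it, every labeling makes some vertex reject; size $O(\log n)$: labels have length $O(\log n)$. *)

(* Defs.v *)
From mathcomp Require Import all_boot all_order ssralg ssrnum ssrint.
Set Implicit Arguments. Unset Strict Implicit. Unset Printing Implicit Defensive.
Import Order.TTheory GRing.Theory Num.Theory.

(* ---------- Finite simple graphs on the vertex set 'I_n.+1 ----------
   Vertex i carries the identifier i.+1, so identifiers are exactly {1,...,n+1}. *)
Record graph (n : nat) := Graph {
  adj : rel 'I_n.+1;
  adj_sym : symmetric adj;
  adj_irr : irreflexive adj }.

Definition connectedG n (G : graph n) : Prop := forall x y, connect (adj G) x y.

Definition component n (G : graph n) (x : 'I_n.+1) : {set 'I_n.+1} :=
  [set y | connect (adj G) x y].

Definition anc (T : finType) (par : T -> T) (u v : T) : bool := fconnect par v u.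

(* par / r describe a rooted tree F with V(F) = C, root r, parent p(v) = par v,
   and every edge of G inside C joins an ancestor/descendant pair. *)
Definition is_elim_tree n (G : graph n) (C : {set 'I_n.+1})
    (par : 'I_n.+1 -> 'I_n.+1) (r : 'I_n.+1) : Prop :=
  [/\ r \in C, par r = r,
      (forall v, v \in C -> par v \in C),
      (forall v, v \in C -> anc par r v) &
      (forall u v, u \in C -> v \in C -> adj G u v -> anc par u v || anc par v u)].

Definition subtree n (C : {set 'I_n.+1}) (par : 'I_n.+1 -> 'I_n.+1) (v : 'I_n.+1)
  : {set 'I_n.+1} := [set w in C | anc par v w].

Definition str n (G : graph n) (C : {set 'I_n.+1}) (par : 'I_n.+1 -> 'I_n.+1)
    (v : 'I_n.+1) : {set 'I_n.+1} :=
  [set u | (u == v) ||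
           [&& u != v, anc par u v & [exists w in subtree C par v, adj G u w]]].

Definition width_le n (G : graph n) (C : {set 'I_n.+1}) (par : 'I_n.+1 -> 'I_n.+1)
    (k : int) : Prop :=
  forall v, v \in C -> ((#|str G C par v|)%:Z - 1 <= k)%R.

Definition is_opath n (G : graph n) (P : seq 'I_n.+1) : bool :=
  if P is x :: s then path (adj G) x s && uniq P else false.

Definition opath_system n (G : graph n) (ps : seq (seq 'I_n.+1)) : bool :=
  all (is_opath G) ps && uniq ps.

Definition congestion_at n (ps : seq (seq 'I_n.+1)) (v : 'I_n.+1) : nat :=
  count (fun P => (v \in P) && ((v == head v P) || (v != last v P))) ps.

Definition witnesses n (G : graph n) (C : {set 'I_n.+1}) (par : 'I_n.+1 -> 'I_n.+1)
    (r : 'I_n.+1) (ps : seq (seq 'I_n.+1)) : Prop :=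
  forall v, v \in C -> v != r ->
    adj G v (par v) \/ exists s, rcons (v :: s) (par v) \in ps.

Definition lvtw_le n (G : graph n) (k : int) : Prop :=
  forall x, exists (par : 'I_n.+1 -> 'I_n.+1) (r : 'I_n.+1) (ps : seq (seq 'I_n.+1)),
    [/\ is_elim_tree G (component G x) par r,
        width_le G (component G x) par k,
        opath_system G ps,
        (forall v, ((congestion_at ps v)%:Z <= k)%R) &
        witnesses G (component G x) par r ps].

(* first-order variables and set variables are indexed by nat (separate sorts) *)
Inductive mso : Type :=
  | MEdge of nat & nat
  | MEq of nat & nat
  | MIn of nat & nat
  | MNot of mso
  | MAnd of mso & mso
  | MOr of mso & mso
  | MEx1 of nat & mso
  | MAll1 of nat & mso
  | MEx2 of nat & mso
  | MAll2 of nat & mso.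

Fixpoint mso_closed (b1 b2 : seq nat) (f : mso) : bool :=
  match f with
  | MEdge x y | MEq x y => (x \in b1) && (y \in b1)
  | MIn x X => (x \in b1) && (X \in b2)
  | MNot g => mso_closed b1 b2 g
  | MAnd g h | MOr g h => mso_closed b1 b2 g && mso_closed b1 b2 h
  | MEx1 x g | MAll1 x g => mso_closed (x :: b1) b2 g
  | MEx2 X g | MAll2 X g => mso_closed b1 (X :: b2) g
  end.

Definition mso_sentence (f : mso) : bool := mso_closed [::] [::] f.

Fixpoint mso_holds n (G : graph n) (e1 : nat -> 'I_n.+1) (e2 : nat -> {set 'I_n.+1})
    (f : mso) : Prop :=
  match f with
  | MEdge x y => adj G (e1 x) (e1 y)
  | MEq x y => e1 x = e1 y
  | MIn x X => e1 x \in e2 X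
  | MNot g => ~ mso_holds G e1 e2 g
  | MAnd g h => mso_holds G e1 e2 g /\ mso_holds G e1 e2 h
  | MOr g h => mso_holds G e1 e2 g \/ mso_holds G e1 e2 h
  | MEx1 x g => exists v, mso_holds G (fun i => if i == x then v else e1 i) e2 g
  | MAll1 x g => forall v, mso_holds G (fun i => if i == x then v else e1 i) e2 g
  | MEx2 X g => exists S, mso_holds G e1 (fun i => if i == X then S else e2 i) g
  | MAll2 X g => forall S, mso_holds G e1 (fun i => if i == X then S else e2 i) g
  end.

(* G |= psi (for a sentence the assignment is irrelevant) *)
Definition models n (G : graph n) (psi : mso) : Prop :=
  mso_holds G (fun _ => ord0) (fun _ => set0) psi.

Definition view n (G : graph n) (lab : 'I_n.+1 -> bitseq) (v : 'I_n.+1)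
  : seq (nat * bitseq) :=
  [seq ((val w).+1, lab w) | w <- enum 'I_n.+1 & (w == v) || adj G v w].

Definition has_log_PLS (cls : forall n, graph n -> Prop) : Prop :=
  exists (Pr : forall n, graph n -> 'I_n.+1 -> bitseq)
         (Vf : nat -> seq (nat * bitseq) -> bool),
    [/\
        (forall n (G : graph n), cls n G -> forall v, Vf (val v).+1 (view G (Pr n G) v)),
        (forall n (G : graph n), ~ cls n G ->
           forall lab, exists v, ~~ Vf (val v).+1 (view G lab v)) &
        exists c, forall n (G : graph n), cls n G ->
           forall v, size (Pr n G v) <= c * (trunc_log 2 n.+1).+1].

(* Main.v *)
Require Import Defs.
From mathcomp Require Import all_boot all_order ssralg ssrnum ssrint.
From mathcomp Require Import boolp zify.
Set Implicit Arguments. Unset Strict Implicit. Unset Printing Implicit Defensive.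

(** The certificate of a vertex consists of its parent and depth in an
    elimination tree, the vertices of [str v] indexed by a colouring with
    [omega + 1] colours that is injective on every [str v], and the state that a
    tree automaton reaches on the forest below it.  An edge of the graph joins a
    vertex to the closest ancestor of some colour, so the graph is encoded by a
    tree over a finite alphabet, and MSO becomes recognizable by automata on the
    first-child/next-sibling encoding (closure under complement, product and
    projection).  A vertex that is not adjacent to its parent has a copy of its
    information carried along its path of the oriented path system; the bounded
    congestion keeps labels short, and counters along the path ensure that each
    parent sees the genuine information of each of its children.  Connectivity is
    certified by the distance to the vertex with the smallest identifier. *)

(** * Labelled binary trees and finite tree automata *)

Inductive btree (A : Type) := Leaf | Bnode of A & btree A & btree A.
Arguments Leaf {A}.

Fixpoint bmap A B (f : A -> B) t :=
  if t is Bnode a c s then Bnode (f a) (bmap f c) (bmap f s) else Leaf.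

Fixpoint bnodes A (t : btree A) : seq A :=
  if t is Bnode a c s then a :: bnodes c ++ bnodes s else [::].

Fixpoint brun A Q (q0 : Q) (delta : A -> Q -> Q -> Q) t :=
  if t is Bnode a c s then delta a (brun q0 delta c) (brun q0 delta s) else q0.

Lemma bnodes_map A B (f : A -> B) t : bnodes (bmap f t) = map f (bnodes t).
Proof. by elim: t => //= a c -> s ->; rewrite map_cat. Qed.

Lemma bmap_comp A B C (f : B -> C) (g : A -> B) t :
  bmap f (bmap g t) = bmap (f \o g) t.
Proof. by elim: t => //= a c -> s ->. Qed.

Lemma brun_map A B Q (q0 : Q) delta (f : A -> B) t :
  brun q0 delta (bmap f t) = brun q0 (fun a => delta (f a)) t.
Proof. by elim: t => //= a c -> s ->. Qed.

(* Every node occurs once, so the annotation is a function of the node. *)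
Lemma bmap_fst_lift (V : eqType) A (g : V -> A) t (t' : btree (A * bool)) :
  uniq (bnodes t) -> bmap fst t' = bmap g t ->
  exists h : V -> bool, t' = bmap (fun v => (g v, h v)) t.
Proof.
(* Allowing any [h'] that agrees with [h] on the nodes makes the induction work: the functions found
   for the two subtrees are glued into one. *)
suff: uniq (bnodes t) -> bmap fst t' = bmap g t ->
  exists h : V -> bool, forall h', {in bnodes t, h =1 h'} ->
  t' = bmap (fun v => (g v, h' v)) t.
  by move=> H ut et; case: (H ut et) => h Hh; exists h; apply: Hh.
elim: t t' => [|v c IHc s IHs] [|[a b] c' s'] //=; first by exists xpred0.
rewrite cat_uniq mem_cat negb_or -andbA => /and5P[vc vs uc /hasPn cs us].
case=> -> /(IHc _ uc)[h1 H1] /(IHs _ us)[h2 H2].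
exists (fun w => if w == v then b else if w \in bnodes c then h1 w else h2 w).
move=> h' Hh; rewrite -(Hh v) ?mem_head // eqxx.
congr Bnode.
  apply: H1 => w wc; rewrite -Hh ?inE ?mem_cat ?wc ?orbT //.
  by case: eqP => // e; rewrite e (negbTE vc) in wc.
apply: H2 => w ws; rewrite -Hh ?inE ?mem_cat ?ws ?orbT //.
by rewrite (negbTE (cs w ws)); case: eqP => // e; rewrite e (negbTE vs) in ws.
Qed.

(** Only the state set is finite. The alphabet is arbitrary, since letters will carry valuations of
    infinitely many variables. *)
Definition recognizable A (L : btree A -> Prop) :=
  exists (Q : finType) (q0 : Q) (delta : A -> Q -> Q -> Q) (F : pred Q),
    forall t, L t <-> F (brun q0 delta t).

Lemma recognizable_not A (L : btree A -> Prop) :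
  recognizable L -> recognizable (fun t => ~ L t).
Proof.
case=> Q [q0 [d [F H]]]; exists Q, q0, d, (predC F) => t /=.
by rewrite H; split=> /negP.
Qed.

Lemma recognizable_and A (L1 L2 : btree A -> Prop) :
  recognizable L1 -> recognizable L2 -> recognizable (fun t => L1 t /\ L2 t).
Proof.
case=> Q1 [q1 [d1 [F1 H1]]] [Q2 [q2 [d2 [F2 H2]]]].
exists (Q1 * Q2)%type, (q1, q2), (fun a x y => (d1 a x.1 y.1, d2 a x.2 y.2)),
  (fun x => F1 x.1 && F2 x.2) => t.
have -> : brun (q1, q2) (fun a x y => (d1 a x.1 y.1, d2 a x.2 y.2)) t
  = (brun q1 d1 t, brun q2 d2 t) by elim: t => //= a c -> s ->.
by rewrite H1 H2; split=> /andP.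
Qed.

Lemma recognizable_preim A B (g : A -> B) (L : btree B -> Prop) :
  recognizable L -> recognizable (fun t => L (bmap g t)).
Proof.
case=> Q [q0 [d [F H]]]; exists Q, q0, (fun a => d (g a)), F => t.
by rewrite H brun_map.
Qed.

(** Subset construction: after a tree, the state is the set of states reachable under some choice of
    the erased bits. *)
Lemma recognizable_proj A (L : btree (A * bool) -> Prop) :
  recognizable L -> recognizable (fun t => exists2 t', bmap fst t' = t & L t').
Proof.
case=> Q [q0 [d [F H]]].
pose D a (X Y : {set Q}) :=
  [set q | [exists b : bool, exists x in X, exists y in Y, q == d (a, b) x y]].
exists {set Q}, [set q0], D, (fun X : {set Q} => [exists x in X, F x]) => t.
have R q : q \in brun [set q0] D t <-> exists2 t', bmap fst t' = t & q = brun q0 d t'.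
  elim: t q => [|a c IHc s IHs] q /=.
    rewrite inE; split=> [/eqP->|[[|??] //= _ ->] //]; by exists Leaf.
  rewrite inE; split.
    case/existsP=> b /exists_inP[x /IHc[c' <- ->]] /exists_inP[y /IHs[s' <- ->]] /eqP->.
    by exists (Bnode (a, b) c' s').
  case=> [[|[a' b] c' s']] //= [ea ec es] ->; subst a c s.
  apply/existsP; exists b; apply/exists_inP; exists (brun q0 d c').
    by apply/IHc; exists c'.
  apply/exists_inP; exists (brun q0 d s') => //.
  by apply/IHs; exists s'.
split.
  by case=> t' et /H Ft; apply/exists_inP; exists (brun q0 d t') => //; apply/R; exists t'.
by case/exists_inP=> x /R[t' et ->] Ft; exists t' => //; apply/H.
Qed.

Lemma recognizable_has A (p : pred A) : recognizable (fun t => has p (bnodes t)).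
Proof.
exists bool, false, (fun a x y => [|| p a, x | y]), id => t.
suff -> : brun false (fun a x y => [|| p a, x | y]) t = has p (bnodes t) by [].
by elim: t => //= a c -> s ->; rewrite has_cat.
Qed.

Lemma recognizable_count1 A (p : pred A) :
  recognizable (fun t => count p (bnodes t) = 1).
Proof.
(* A counter saturating at 2 suffices to recognize the value 1. *)
pose D a (x y : 'I_3) : 'I_3 := inord (minn 2 (p a + x + y)).
exists 'I_3, ord0, D, (fun x => val x == 1) => t.
have -> : val (brun ord0 D t) = minn 2 (count p (bnodes t)).
  elim: t => //= a c IHc s IHs; rewrite /D inordK ?count_cat; last by lia.
  by move: IHc IHs => /= -> ->; lia.
by split=> [->//|/eqP]; lia.
Qed.

(** * MSO on coloured trees *)

(* A vertex [v] of a tree is labelled by its colour and by the set of colours of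
   its neighbours among its ancestors; a colour [a] refers to the closest
   strict ancestor of that colour. *)
Definition tlabel K := ('I_K * {set 'I_K})%type.

(** The reference of colour [a] made by [w] leaves the forest [t] upwards, unblocked by a strict
    ancestor of that colour. Here [c] holds the children of [u] and [s] its later siblings, so [u]
    can block only references coming from [c]. *)
Fixpoint breach (V : eqType) K (l : V -> tlabel K) t (a : 'I_K) (w : V) : bool :=
  if t is Bnode u c s then
    [|| (w == u) && (a \in (l u).2),
        (a != (l u).1) && breach l c a w | breach l s a w]
  else false.

(** The first vertex is the upper endpoint: [w] refers to the colour of [u], and the reference
    escapes the forest of children of [u]. *)
Fixpoint bedge (V : eqType) K (l : V -> tlabel K) t (u w : V) : bool :=
  if t is Bnode v c s then
    [|| (u == v) && breach l c (l v).1 w, bedge l c u w | bedge l s u w]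
  else false.

Definition tree_model n K (G : graph n) (t : btree 'I_n.+1) (l : 'I_n.+1 -> tlabel K) :=
  [/\ uniq (bnodes t), forall v, v \in bnodes t &
      forall u w, adj G u w = bedge l t u w || bedge l t w u].

Definition letter K := (tlabel K * (nat -> bool) * (nat -> bool))%type.

Definition val_letter n K (l : 'I_n.+1 -> tlabel K) e1 (e2 : nat -> {set 'I_n.+1}) v
  : letter K := (l v, fun i => e1 i == v, fun i => v \in e2 i).

(** Automaton for an edge atom: the state tells whether the edge was already met, and which colours
    referred to by the values of [x] and of [y] are still unresolved. *)
Definition edge_step K x y (a : letter K) (p q : bool * {set 'I_K} * {set 'I_K}) :=
  let: ((col, N), b, _) := a in
  let: (f1, X1, Y1) := p in let: (f2, X2, Y2) := q in
  ([|| f1, f2, b x && (col \in Y1) | b y && (col \in X1)],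
   X2 :|: X1 :\ col :|: (if b x then N else set0),
   Y2 :|: Y1 :\ col :|: (if b y then N else set0)).

Lemma edge_stepP n K (l : 'I_n.+1 -> tlabel K) e1 (e2 : nat -> {set 'I_n.+1}) x y t :
  brun (false, set0, set0) (edge_step x y) (bmap (val_letter l e1 e2) t) =
  (bedge l t (e1 x) (e1 y) || bedge l t (e1 y) (e1 x),
   [set a | breach l t a (e1 x)], [set a | breach l t a (e1 y)]).
Proof.
elim: t => [|v c IHc s IHs] /=.
  by rewrite /=; do 2?congr pair; apply/setP=> a; rewrite !inE.
rewrite IHc IHs /edge_step /val_letter; case: (l v) => col N /=.
congr (_, _, _).
- rewrite !inE; do !case: (bedge _ _ _ _); rewrite ?orbT ?orbF //=.
- apply/setP=> a; rewrite !inE; case: (e1 x == v); rewrite /= ?inE ?orbF //.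
  + by case: (a \in N); rewrite ?orbT ?orbF //= orbC.
  + by rewrite orbC.
- apply/setP=> a; rewrite !inE; case: (e1 y == v); rewrite /= ?inE ?orbF //.
  + by case: (a \in N); rewrite ?orbT ?orbF //= orbC.
  + by rewrite orbC.
Qed.

Definition upd1 K x (ab : letter K * bool) : letter K :=
  (ab.1.1.1, fun i => if i == x then ab.2 else ab.1.1.2 i, ab.1.2).
Definition upd2 K x (ab : letter K * bool) : letter K :=
  (ab.1.1, fun i => if i == x then ab.2 else ab.1.2 i).

Definition mso_rec K (f : mso) := exists L : btree (letter K) -> Prop,
  recognizable L /\ forall n (G : graph n) t l, tree_model G t l -> forall e1 e2,
    mso_holds G e1 e2 f <-> L (bmap (val_letter l e1 e2) t).

Lemma mso_rec_iff K f g :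
  (forall n (G : graph n) e1 e2, mso_holds G e1 e2 f <-> mso_holds G e1 e2 g) ->
  mso_rec K f -> mso_rec K g.
Proof. by move=> fg [L [rL H]]; exists L; split=> // *; rewrite -fg; apply: H. Qed.

Lemma mso_rec_not K f : mso_rec K f -> mso_rec K (MNot f).
Proof.
case=> L [rL H]; exists (fun t => ~ L t); split; first exact: recognizable_not.
by move=> n G t l m e1 e2 /=; rewrite (H _ _ _ _ m).
Qed.

Lemma mso_rec_and K f g : mso_rec K f -> mso_rec K g -> mso_rec K (MAnd f g).
Proof.
case=> L [rL H] [L' [rL' H']]; exists (fun t => L t /\ L' t).
split; first exact: recognizable_and.
by move=> n G t l m e1 e2 /=; rewrite (H _ _ _ _ m) (H' _ _ _ _ m).
Qed.

Lemma mso_rec_ex2 K X f : mso_rec K f -> mso_rec K (MEx2 X f).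
Proof.
case=> L [rL H].
exists (fun t => exists2 t', bmap fst t' = t & L (bmap (upd2 X) t')).
split; first exact/recognizable_proj/recognizable_preim.
move=> n G t l m e1 e2 /=; have [ut _ _] := m.
have E h (S : {set 'I_n.+1}) : (forall v, h v = (v \in S)) -> upd2 X \o (fun v => (val_letter l e1 e2 v, h v))
    = val_letter l e1 (fun i => if i == X then S else e2 i).
  move=> hS; apply/funext=> v; rewrite /upd2 /val_letter /=; congr pair.
  by apply/funext=> i; case: eqP.
split.
  case=> S /(H _ _ _ _ m) LS; exists (bmap (fun v => (val_letter l e1 e2 v, v \in S)) t).
    by rewrite bmap_comp.
  by rewrite bmap_comp (E _ S).
case=> t' /(bmap_fst_lift ut)[h ->]; rewrite bmap_comp => Lt.
exists [set v | h v]; apply/(H _ _ _ _ m); rewrite -(E h) // => v.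
by rewrite inE.
Qed.

(** A vertex quantifier is a projection restricted to annotations that mark exactly one node. *)
Lemma mso_rec_ex1 K x f : mso_rec K f -> mso_rec K (MEx1 x f).
Proof.
case=> L [rL H].
exists (fun t => exists2 t', bmap fst t' = t &
  (count snd (bnodes t') = 1 /\ L (bmap (upd1 x) t'))).
split.
  apply/recognizable_proj/recognizable_and; first exact: recognizable_count1.
  exact: recognizable_preim.
move=> n G t l m e1 e2 /=; have [ut tT _] := m.
have E h u : (forall v, h v = (u == v)) -> upd1 x \o (fun v => (val_letter l e1 e2 v, h v))
    = val_letter l (fun i => if i == x then u else e1 i) e2.
  move=> hS; apply/funext=> v; rewrite /upd1 /val_letter /=; congr (_, _, _).
  by apply/funext=> i; case: eqP.
split.
  case=> u /(H _ _ _ _ m) LS; exists (bmap (fun v => (val_letter l e1 e2 v, u == v)) t).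
    by rewrite bmap_comp.
  rewrite bmap_comp (E _ u) //; split=> //.
  rewrite bnodes_map count_map.
  have -> : count (preim (fun v => (val_letter l e1 e2 v, u == v)) snd) (bnodes t)
    = count_mem u (bnodes t) by apply: eq_count => v /=; rewrite eq_sym.
  by rewrite count_uniq_mem ?tT.
case=> t' /(bmap_fst_lift ut)[h ->]; rewrite bmap_comp => -[].
rewrite bnodes_map count_map => c1 Lt.
have: has h (bnodes t) by rewrite has_count c1.
case/hasP=> u ub hu; exists u; apply/(H _ _ _ _ m); rewrite -(E h) // => v.
apply/idP/eqP => [hv|<-//]; apply/eqP; apply/negP => /negP uv.
(* A second marked vertex [v] would raise the count to at least 2. *)
have: count (pred2 u v) (bnodes t) <= count h (bnodes t).
  by apply: sub_count => z /orP[]/eqP->.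
rewrite c1 -(eq_count (a1 := predU (pred1 u) (pred1 v))) //.
have := count_predUI (pred1 u) (pred1 v) (bnodes t).
have -> : count (predI (pred1 u) (pred1 v)) (bnodes t) = 0.
  apply/eqP; rewrite -leqn0 leqNgt -has_count; apply/hasP => -[z _ /andP[/eqP-> ]].
  by rewrite /= (negbTE uv).
rewrite !count_uniq_mem // !tT; lia.
Qed.

Theorem mso_recognizable K f : mso_rec K f.
Proof.
elim: f => [x y|x y|x X|f IH|f IHf g IHg|f IHf g IHg|x f IH|x f IH|X f IH|X f IH].
- pose L (t : btree (letter K)) := (brun (false, set0, set0) (edge_step x y) t).1.1 : Prop.
  exists L; split.
    by exists _, (false, set0, set0), (edge_step x y), (fun p => p.1.1).
  by move=> n G t l [_ _ H] e1 e2 /=; rewrite /L edge_stepP H.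
- exists (fun t => has (fun a : letter K => a.1.2 x && a.1.2 y) (bnodes t)).
  split; first exact: recognizable_has.
  move=> n G t l [_ tT _] e1 e2 /=; rewrite bnodes_map has_map.
  split=> [e|/hasP[v _ /andP[/eqP-> /eqP->]] //].
  by apply/hasP; exists (e1 x) => //=; rewrite e eqxx.
- exists (fun t => has (fun a : letter K => a.1.2 x && a.2 X) (bnodes t)).
  split; first exact: recognizable_has.
  move=> n G t l [_ tT _] e1 e2 /=; rewrite bnodes_map has_map.
  split=> [e|/hasP[v _ /andP[/eqP-> //]]].
  by apply/hasP; exists (e1 x) => //=; rewrite e eqxx.
- exact: mso_rec_not.
- exact: mso_rec_and.
(* Disjunction, and below the universal quantifiers, reduce to earlier cases by classical
   duality. *)
- apply: (mso_rec_iff (f := MNot (MAnd (MNot f) (MNot g)))).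
    by move=> n G e1 e2 /=; rewrite not_andE !notE.
  by apply/mso_rec_not/mso_rec_and; apply: mso_rec_not.
- exact: mso_rec_ex1.
- apply: (mso_rec_iff (f := MNot (MEx1 x (MNot f)))).
    by move=> n G e1 e2 /=; rewrite -forallNE; split=> H v; [exact: contrapT|apply; exact: H].
  exact/mso_rec_not/mso_rec_ex1/mso_rec_not.
- exact: mso_rec_ex2.
- apply: (mso_rec_iff (f := MNot (MEx2 X (MNot f)))).
    by move=> n G e1 e2 /=; rewrite -forallNE; split=> H v; [exact: contrapT|apply; exact: H].
  exact/mso_rec_not/mso_rec_ex2/mso_rec_not.
Qed.

(** * Elimination trees as coloured binary trees *)

(** First-child/next-sibling encoding of the forest with roots [s]; [m] is fuel bounding the number
    of levels. *)
Fixpoint bforest V (ch : V -> seq V) m (s : seq V) : btree V :=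
  if m is m'.+1 then foldr (fun c acc => Bnode c (bforest ch m' (ch c)) acc) Leaf s
  else Leaf.

Lemma bnodes_forest V (ch : V -> seq V) m s :
  bnodes (bforest ch m.+1 s) =
  flatten [seq c :: bnodes (bforest ch m (ch c)) | c <- s].
Proof. by elim: s => //= c s ->. Qed.

Lemma breach_forest (V : eqType) K (l : V -> tlabel K) ch m s a w :
  breach l (bforest ch m.+1 s) a w =
  has (fun c => (w == c) && (a \in (l c).2)
                || (a != (l c).1) && breach l (bforest ch m (ch c)) a w) s.
Proof. by elim: s => //= c s <-; rewrite orbA. Qed.

Lemma bedge_forest (V : eqType) K (l : V -> tlabel K) ch m s u w :
  bedge l (bforest ch m.+1 s) u w =
  has (fun c => (u == c) && breach l (bforest ch m (ch c)) (l c).1 w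
                || bedge l (bforest ch m (ch c)) u w) s.
Proof. by elim: s => //= c s <-; rewrite orbA. Qed.

(** Truncated predecessor lets one equation cover the root too: its parent has depth 0, hence is the
    root. *)
Definition ranked n (par : 'I_n.+1 -> 'I_n.+1) d r :=
  (forall v, d v = 0 <-> v = r) /\ (forall v, d (par v) = (d v).-1).

Section Ranked.
Variables (n : nat) (par : 'I_n.+1 -> 'I_n.+1) (d : 'I_n.+1 -> nat) (r : 'I_n.+1).
Hypothesis RK : ranked par d r.

Lemma rk_par_root : par r = r.
Proof. by apply/RK.1; rewrite RK.2; have /RK.1 -> := erefl r. Qed.

Lemma rk_iter j v : d (iter j par v) = d v - j.
Proof. by elim: j => [|j IH] /=; rewrite ?subn0 // RK.2 IH; lia. Qed.

Lemma rk_iter_root v : iter (d v) par v = r.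
Proof. by apply/RK.1; rewrite rk_iter subnn. Qed.

Lemma rk_anc_root v : anc par r v.
Proof. by rewrite /anc -(rk_iter_root v) fconnect_iter. Qed.

Lemma rk_anc_lt u v : anc par u v -> u != v -> d u < d v.
Proof.
rewrite /anc => /iter_findex <-; set j := findex _ _ _ => ne.
rewrite rk_iter; case: (posnP j) => [j0|j0]; first by rewrite j0 eqxx in ne.
case: (posnP (d v)) => [/RK.1 vr|]; last by lia.
have fixr i : iter i par r = r by elim: i => // i IH; rewrite iterSr rk_par_root.
by rewrite vr fixr eqxx in ne.
Qed.

End Ranked.

(* Local conditions describing an elimination tree of [G] with parent map
   [par], depth [d] and root [r], together with a colouring [col] that is
   injective on every [str v]; [S v] maps the colours of [str v] to vertices. *)
Record elim_model n K (G : graph n) (par : 'I_n.+1 -> 'I_n.+1) (d : 'I_n.+1 -> nat)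
    (r : 'I_n.+1) (col : 'I_n.+1 -> 'I_K) (S : 'I_n.+1 -> 'I_K -> option 'I_n.+1) : Prop :=
  ElimModel {
    em_root v : d v = 0 <-> v = r;
    em_par v : d (par v) = (d v).-1;
    em_self v : S v (col v) = Some v;
    em_rootS a u : S r a = Some u -> a = col r;
    em_adj u v : adj G u v -> d u != d v;
    em_nbr u v : adj G u v -> d u < d v -> S v (col u) = Some u;
    em_up v a u : 0 < d v -> a != col v -> S v a = Some u -> S (par v) a = Some u }.

Definition nbr_cols n K (G : graph n) (S : 'I_n.+1 -> 'I_K -> option 'I_n.+1) v
  : {set 'I_K} := [set a | if S v a is Some u then adj G v u else false].

Definition children n (par : 'I_n.+1 -> 'I_n.+1) (d : 'I_n.+1 -> nat)
    (ch : 'I_n.+1 -> seq 'I_n.+1) :=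
  (forall p, uniq (ch p)) /\ (forall p c, (c \in ch p) = (0 < d c) && (par c == p)).

Section ElimModel.
Variables (n K : nat) (G : graph n) (par : 'I_n.+1 -> 'I_n.+1) (d : 'I_n.+1 -> nat).
Variables (r : 'I_n.+1) (col : 'I_n.+1 -> 'I_K) (S : 'I_n.+1 -> 'I_K -> option 'I_n.+1).
Hypothesis EM : elim_model G par d r col S.

Lemma em_ranked : ranked par d r.
Proof. by split; [apply: em_root EM|apply: em_par EM]. Qed.

Let em_iter := rk_iter em_ranked.
Let em_iter_root := rk_iter_root em_ranked.
Let em_anc_lt := rk_anc_lt em_ranked.

(* A colour known at [v] stays known on the way up until its vertex is met. *)
Lemma em_climb v a u : S v a = Some u ->
  exists2 j, iter j par v = u & a = col u /\
    (j <= d v /\ forall i, i <= j -> S (iter i par v) a = Some u /\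
                 (i < j -> col (iter i par v) != a)).
Proof.
move: {2}(d v) (erefl (d v)) => m; elim: m v => [|m IH] v dv Sv.
  have vr := (em_root EM v).1 dv; have ar : a = col v by move: Sv; rewrite vr => /(em_rootS EM).
  move: Sv; rewrite {1}ar (em_self EM) => -[vu]; subst u.
  exists 0 => //; split=> //; split=> // i; rewrite leqn0 => /eqP->; split=> //=.
  by rewrite ar (em_self EM).
case: (eqVneq a (col v)) => [ar|ne].
  move: Sv; rewrite {1}ar (em_self EM) => -[vu]; subst u.
  exists 0 => //; split=> //; split=> // i; rewrite leqn0 => /eqP->; split=> //=.
  by rewrite ar (em_self EM).
have Sp : S (par v) a = Some u by apply: (em_up EM) => //; rewrite dv.
have [|j ju [ac [jd H]]] := IH (par v) _ Sp; first by rewrite (em_par EM) dv.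
exists j.+1; first by rewrite iterSr.
split=> //; split; first by move: jd; rewrite (em_par EM) dv.
case=> [_|i ij]; first by split=> // _; rewrite eq_sym.
by rewrite iterSr; apply: H.
Qed.

Lemma em_adj_anc u v : adj G u v -> d u < d v -> anc par u v.
Proof.
move=> uv lt; have [j <- _] := em_climb (em_nbr EM uv lt).
exact: fconnect_iter.
Qed.

(** If [u] has a neighbour [w] below [v], the climb from [w] to [u] along the colour of [u] passes
    through [v], where that colour is therefore still assigned to [u]. *)
Lemma em_str C v : str G C par v \subset [set u | [exists a, S v a == Some u]].
Proof.
apply/subsetP=> u; rewrite !inE => /orP[/eqP->|/and3P[ne uv]].
  by apply/existsP; exists (col v); rewrite (em_self EM).
case/exists_inP=> w; rewrite inE => /andP[_ vw] uw.
have luv := em_anc_lt uv ne.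
have := vw; rewrite /anc => /iter_findex; set i := findex _ _ _ => iw.
have dvw : d v = d w - i by rewrite -iw em_iter.
have luw : d u < d w by lia.
have [j ju [_ [jd H]]] := em_climb (em_nbr EM uw luw).
have du : d u = d w - j by rewrite -ju em_iter.
have [|Sv _] := H i _; first by lia.
by apply/existsP; exists (col u); rewrite -iw Sv.
Qed.

Lemma card_em_str C v : #|str G C par v| <= K.
Proof.
apply: leq_trans (subset_leq_card (em_str C v)) _.
have -> : #|[set u | [exists a, S v a == Some u]]|
        = #|[set Some u | u in [set u | [exists a, S v a == Some u]]]|.
  by rewrite card_imset //; apply: Some_inj.
apply: leq_trans (_ : #|[set S v a | a : 'I_K]| <= _).
  apply/subset_leq_card/subsetP=> x /imsetP[u]; rewrite inE => /existsP[a /eqP<-] ->.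
  exact: imset_f.
by apply: leq_trans (leq_imset_card _ _) _; rewrite card_ord.
Qed.

Lemma em_elim_tree C : C = [set: 'I_n.+1] -> is_elim_tree G C par r.
Proof.
move=> ->; split; [by rewrite inE|exact: rk_par_root em_ranked|by move=> v; rewrite !inE| |].
  by move=> v _; apply: rk_anc_root em_ranked _.
move=> u v _ _ uv; have := em_adj EM uv; case: ltngtP => // lt _; apply/orP.
  by left; apply: em_adj_anc.
by right; apply: em_adj_anc => //; rewrite adj_sym.
Qed.

Variable ch : 'I_n.+1 -> seq 'I_n.+1.
Hypothesis CH : children par d ch.
Let l v := (col v, nbr_cols G S v).
Let N := (\max_v d v).+1.
Definition em_tree := bforest ch N [:: r].

Lemma em_dlt v : d v < N.
Proof. by rewrite ltnS; apply: leq_bigmax. Qed.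

(** The fuel [m] equals the number of levels from depth [D] on, so no vertex below [s] is cut
    off. *)
Lemma em_nodes m D s : N = D + m -> (forall c, c \in s -> d c = D) -> forall w,
  (w \in bnodes (bforest ch m s)) = (D <= d w) && (iter (d w - D) par w \in s).
Proof.
elim: m D s => [|m IH] D s eN sD w.
  by rewrite in_nil; have := em_dlt w; rewrite eN addn0 => lt; rewrite leqNgt lt.
rewrite bnodes_forest.
apply/flattenP/andP.
  case=> x /mapP[c cs ->]; have dc := sD c cs; rewrite inE => /orP[/eqP->|].
    by rewrite dc subnn.
  rewrite (IH D.+1); [|by lia|]; last first.
    by move=> c'; rewrite CH.2 => /andP[c0 /eqP e]; have := em_par EM c'; rewrite e; lia.
  rewrite CH.2 => /andP[lt /andP[_ /eqP e]]; split; first by lia.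
  by have -> : d w - D = (d w - D.+1).+1 by [lia]; rewrite iterS e.
case=> le; set c := iter _ _ _ => cs; exists (c :: bnodes (bforest ch m (ch c))).
  by apply/mapP; exists c.
rewrite inE; case: (eqVneq (d w) D) => [e|ne]; first by rewrite /c e subnn eqxx.
rewrite (IH D.+1) ?orbA; [|by lia|]; last first.
  by move=> c'; rewrite CH.2 => /andP[c0 /eqP e]; have := em_par EM c';
     rewrite e (sD c cs); lia.
rewrite CH.2 em_iter; apply/orP; right; apply/and3P; split; try lia.
by rewrite /c -iterS; have -> : d w - D = (d w - D.+1).+1 by lia.
Qed.

(** A vertex has a unique ancestor at depth [D], so distinct roots have disjoint trees. *)
Lemma em_uniq m D s : N = D + m -> uniq s -> (forall c, c \in s -> d c = D) ->
  uniq (bnodes (bforest ch m s)).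
Proof.
elim: m D s => [|m IH] D s eN us sD //.
have chD c : c \in s -> forall c', c' \in ch c -> d c' = D.+1.
  by move=> cs c'; rewrite CH.2 => /andP[c0 /eqP e]; have := em_par EM c';
     rewrite e (sD c cs); lia.
rewrite bnodes_forest; elim: s us sD chD => //= c s IHs /andP[cs us] sD chD.
have dc := sD c (mem_head _ _); have eN' : N = D.+1 + m by lia.
have nc w := em_nodes eN' (chD c (mem_head _ _)) w.
rewrite mem_cat negb_or -andbA; apply/and3P; split.
- by rewrite nc dc ltnn.
- apply/negP => H.
  have : c \in bnodes (bforest ch m.+1 s) by rewrite bnodes_forest.
  rewrite (em_nodes eN) ?dc ?subnn ?(negbTE cs) ?andbF // => c' c's.
  by apply: sD; rewrite inE c's orbT.
rewrite cat_uniq (IH D.+1) ?CH.1 //; last exact/chD/mem_head.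
rewrite IHs // => [|c' c's|c' c's]; last 2 first.
- by apply: sD; rewrite inE c's orbT.
- by apply: chD; rewrite inE c's orbT.
rewrite andbT; apply/hasPn => w.
have -> : (w \in flatten [seq c0 :: bnodes (bforest ch m (ch c0)) | c0 <- s])
  = (w \in bnodes (bforest ch m.+1 s)) by rewrite bnodes_forest.
rewrite (em_nodes eN) => [/andP[le ws]|c' c's]; last by apply: sD; rewrite inE c's orbT.
rewrite /= nc CH.2; apply/negP => /andP[lt /andP[_ /eqP e]].
have E : d w - D = (d w - D.+1).+1 by lia.
by rewrite E iterS e (negbTE cs) in ws.
Qed.

(** An unblocked reference keeps its meaning on the way up by [em_up], so the map of [p] yields the
    very neighbour meant by [w]. *)
Lemma em_breach_adj m p s a w : {subset s <= ch p} -> breach l (bforest ch m s) a w ->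
  exists2 u, S p a = Some u & adj G w u.
Proof.
elim: m p s => [|m IH] p s sp //; rewrite breach_forest => /hasP[c cs].
have := sp c cs; rewrite CH.2 => /andP[c0 /eqP <-] /orP[/andP[/eqP-> /=]|/andP[/= ne]].
  rewrite inE; case Sc: (S c a) => [u|] // cu; exists u => //.
  (* If [a] were the colour of [c], the map of [c] would send it to [c] itself, which is not its own
     neighbour. *)
  apply: (em_up EM) => //; apply: contraTN cu => /eqP e.
  by move: Sc; rewrite e (em_self EM) => -[<-]; rewrite adj_irr.
case/(IH c) => // u Sc wu; exists u => //.
exact: (em_up EM).
Qed.

Lemma em_bedge_adj m s u w : bedge l (bforest ch m s) u w -> adj G u w.
Proof.
elim: m s => [|m IH] s //; rewrite bedge_forest => /hasP[c cs] /orP[|/IH//].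
case/andP=> /eqP-> /= /(em_breach_adj (p := c)) [] // v.
by rewrite (em_self EM) => -[<-]; rewrite adj_sym.
Qed.

Lemma em_breach m i s a w : i < m -> i <= d w -> iter i par w \in s -> a \in nbr_cols G S w ->
  (forall j, 0 < j <= i -> col (iter j par w) != a) -> breach l (bforest ch m s) a w.
Proof.
elim: i m s => [|i IH] [|m] s // im id ws aw H; rewrite breach_forest; apply/hasP.
  by exists w => //; rewrite eqxx /= aw.
exists (iter i.+1 par w) => //; apply/orP; right; apply/andP; split.
  by rewrite /= eq_sym; apply: (H i.+1); lia.
apply: IH => //; [lia| |by move=> j jl; apply: H; lia].
by rewrite CH.2 em_iter -iterS eqxx andbT; lia.
Qed.

(** There are [i] levels from the roots [s] to [u] and [j] from [u] to [w]; induction on [i]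
    descends to [u]. *)
Lemma em_bedge m i j s u w : i + j < m -> 0 < j <= d w -> iter j par w = u -> i <= d u ->
  iter i par u \in s -> col u \in nbr_cols G S w ->
  (forall k, 0 < k < j -> col (iter k par w) != col u) -> bedge l (bforest ch m s) u w.
Proof.
elim: i m s => [|i IH] [|m] s // im jd ju iu us aw H; rewrite bedge_forest; apply/hasP.
  exists u => //; rewrite eqxx /=; apply/orP; left.
  (* The forest searched consists of the children of [u], one level closer to [w]. *)
  apply: (em_breach (i := j.-1)) => //; [lia|lia| |by move=> k kj; apply: H; lia].
  rewrite CH.2 em_iter -iterS prednK; last by lia.
  by rewrite ju eqxx andbT; lia.
exists (iter i.+1 par u) => //; apply/orP; right.
apply: IH => //; first by lia.
by rewrite CH.2 em_iter -iterS eqxx andbT; lia.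
Qed.

Lemma em_adj_bedge u w : adj G u w -> d u < d w -> bedge l em_tree u w.
Proof.
move=> uw lt; have Su := em_nbr EM uw lt; have [j ju [_ [jd H]]] := em_climb Su.
have du : d u = d w - j by rewrite -ju em_iter.
apply: (em_bedge (i := d u) (j := j)) => //; first by have := em_dlt w; lia.
- lia.
- by rewrite em_iter_root mem_head.
- by rewrite inE Su adj_sym.
- by move=> k kj; apply: (H k _).2; lia.
Qed.

Lemma em_tree_model : tree_model G em_tree l.
Proof.
have r0 : d r = 0 by apply/(em_root EM).
have rs c : c \in [:: r] -> d c = 0 by rewrite inE => /eqP->.
split.
- exact: (@em_uniq _ 0).
- by move=> v; rewrite (em_nodes (D := 0)) // subn0 em_iter_root mem_head.
move=> u w; apply/idP/orP.
  move=> uw; have := em_adj EM uw; case: ltngtP => // lt _.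
    by left; apply: em_adj_bedge.
  by right; apply: em_adj_bedge; rewrite // adj_sym.
by case=> /em_bedge_adj //; rewrite adj_sym.
Qed.

(** The state [st v] belongs to the forest strictly below [v]. Reading the whole tree takes one more
    step at [r], whose sibling forest is empty and contributes [q0]. *)
Lemma em_brun Q (q0 : Q) delta (st : 'I_n.+1 -> Q) :
  (forall v, st v = foldr (fun c q => delta c (st c) q) q0 (ch v)) ->
  brun q0 delta em_tree = delta r (st r) q0.
Proof.
move=> H.
suff E m v : N = (d v).+1 + m -> brun q0 delta (bforest ch m (ch v)) = st v.
  by rewrite /em_tree /N /= E // /N ((em_root EM r).2 erefl).
elim: m v => [|m IH] v eN; have chv c : c \in ch v -> d c = (d v).+1.
- by rewrite CH.2 => /andP[c0 /eqP e]; have := em_par EM c; rewrite e; lia.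
- rewrite H; case: (ch v) chv => // c s /(_ c (mem_head _ _)).
  by have := em_dlt c; lia.
- by rewrite CH.2 => /andP[c0 /eqP e]; have := em_par EM c; rewrite e; lia.
rewrite H /=; elim: (ch v) chv => //= c s IHs Hs; rewrite IHs; last first.
  by move=> c' c's; apply: Hs; rewrite inE c's orbT.
by rewrite IH // Hs ?mem_head //; lia.
Qed.

Lemma em_state Q (q0 : Q) delta : exists st : 'I_n.+1 -> Q,
  forall v, st v = foldr (fun c q => delta c (st c) q) q0 (ch v).
Proof.
exists (fun v => brun q0 delta (bforest ch (N - (d v).+1) (ch v))) => v.
have chv c : c \in ch v -> d c = (d v).+1.
  by rewrite CH.2 => /andP[c0 /eqP e]; have := em_par EM c; rewrite e; lia.
case E: (N - (d v).+1) => [|m] /=.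
  case: (ch v) chv => // c s /(_ c (mem_head _ _)).
  by have := em_dlt c; lia.
elim: (ch v) chv => //= c s IHs Hs; rewrite IHs; last first.
  by move=> c' c's; apply: Hs; rewrite inE c's orbT.
by have -> : N - (d c).+1 = m by rewrite Hs ?mem_head //; lia.
Qed.

End ElimModel.

(** * Prefix codes and labels *)

(** Decoding in front of arbitrary further bits, unlike plain injectivity, is preserved by
    concatenation. *)
Definition prefix_code T (c : T -> bitseq) :=
  forall x y r s, c x ++ r = c y ++ s -> x = y /\ r = s.

Lemma prefix_code_cat T (c : T -> bitseq) x y A B r s : prefix_code c ->
  (c x ++ A) ++ r = (c y ++ B) ++ s -> x = y /\ A ++ r = B ++ s.
Proof. by move=> cP; rewrite -!catA; apply: cP. Qed.

Fixpoint nat_bits m x : bitseq := if m is m'.+1 then odd x :: nat_bits m' x./2 else [::].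

Lemma nat_bits_inj m x y r s : x < 2 ^ m -> y < 2 ^ m ->
  nat_bits m x ++ r = nat_bits m y ++ s -> x = y /\ r = s.
Proof.
elim: m x y => [|m IH] x y /=; first by case: x; case: y.
rewrite !expnS => lx ly [e /IH[]]; try lia.
by move=> e2 ->; split=> //; rewrite -(odd_double_half x) e e2 odd_double_half.
Qed.

(** The number of bits in unary, a separator, then the bits: the code delimits itself and has
    logarithmic length. *)
Definition code_nat x : bitseq :=
  let m := (trunc_log 2 x).+1 in nseq m true ++ false :: nat_bits m x.

Lemma unary_inj a b (r s : bitseq) :
  nseq a true ++ false :: r = nseq b true ++ false :: s -> a = b /\ r = s.
Proof. by elim: a b => [|a IH] [|b] //= []; [|case/IH=> ->]. Qed.

Lemma code_natP : prefix_code code_nat.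
Proof.
move=> x y r s; rewrite /code_nat.
have := @trunc_log_ltn 2 x isT; have := @trunc_log_ltn 2 y isT.
move: (trunc_log 2 x).+1 (trunc_log 2 y).+1 => m m' ly lx.
rewrite -!catA !cat_cons => /unary_inj[em]; rewrite em in lx *.
exact: nat_bits_inj.
Qed.

Lemma size_code_nat N x : x <= N -> size (code_nat x) <= 3 * (trunc_log 2 N).+1.
Proof.
move=> xN; have E m y : size (nat_bits m y) = m by elim: m y => //= m IH y; rewrite IH.
rewrite /code_nat /= size_cat size_nseq /= E.
have := leq_trunc_log 2 xN; lia.
Qed.

Definition code_fin (T : finType) (x : T) := code_nat (enum_rank x).

Lemma code_finP (T : finType) : prefix_code (@code_fin T).
Proof.
by move=> x y r s /code_natP[/ord_inj/enum_rank_inj-> ->].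
Qed.

Lemma size_code_fin (T : finType) (x : T) : size (code_fin x) <= 3 * (trunc_log 2 #|T|).+1.
Proof. exact/size_code_nat/ltnW/ltn_ord. Qed.

Definition code_opt (x : option nat) := code_nat (if x is Some y then y.+1 else 0).

Lemma code_optP : prefix_code code_opt.
Proof.
by move=> x y r s /code_natP[e ->]; split=> //; case: x y e => [x|] [y|] // [->].
Qed.

Fixpoint code_seq T (c : T -> bitseq) s : bitseq :=
  if s is x :: s' then true :: c x ++ code_seq c s' else [:: false].

Lemma code_seqP T (c : T -> bitseq) : prefix_code c -> prefix_code (code_seq c).
Proof.
move=> cP; elim=> [|x s IH] [|y t] r r' //=; first by case.
by rewrite -!catA => -[/cP[-> /IH[-> ->]]].
Qed.

Lemma size_code_seq (T : Type) (c : T -> bitseq) s b :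
  (forall x, List.In x s -> size (c x) <= b) -> size (code_seq c s) <= size s * b.+1 + 1.
Proof.
elim: s => //= x s IH H; rewrite size_cat.
have := H x (or_introl erefl).
have /IH : forall x, List.In x s -> size (c x) <= b by move=> y ys; apply: H; right.
by rewrite mulSn; lia.
Qed.

(* Identifiers are shifted to start from 0, and the root is its own parent. *)
Record info K (Q : Type) := Info {
  i_id : nat; i_par : nat; i_dep : nat; i_col : 'I_K;
  i_S : {ffun 'I_K -> option nat}; i_N : {set 'I_K}; i_st : Q }.

(* A copy of the information of [e_inf], at distance [e_pos] from the start
   of its path and followed by [e_rem] further internal vertices. *)
Record entry K Q := Entry { e_inf : info K Q; e_pos : nat; e_rem : nat }.

(* [l_root] is the root of the elimination tree, [l_dist] the distance to the
   vertex 0. *)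
Record label K Q := Label { l_inf : info K Q; l_root : nat; l_dist : nat;
  l_ents : seq (entry K Q) }.

Definition code_info K (Q : finType) (I : info K Q) :=
  code_nat (i_id I) ++ code_nat (i_par I) ++ code_nat (i_dep I) ++
  code_fin (i_col I, i_N I, i_st I) ++ code_seq code_opt (codom (i_S I)).

Definition code_entry K (Q : finType) (e : entry K Q) :=
  code_info (e_inf e) ++ code_nat (e_pos e) ++ code_nat (e_rem e).

Definition code_label K (Q : finType) (L : label K Q) :=
  code_info (l_inf L) ++ code_nat (l_root L) ++ code_nat (l_dist L) ++
  code_seq (@code_entry K Q) (l_ents L).

Lemma code_infoP K (Q : finType) : prefix_code (@code_info K Q).
Proof.
move=> [a b c d e f g] [a' b' c' d' e' f' g'] r s.
do 3!case/(prefix_code_cat code_natP)=> /= ->.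
case/(prefix_code_cat (@code_finP _))=> -[-> -> ->].
case/(code_seqP code_optP) => E ->; split=> //.
have -> // : e = e'.
apply/ffunP=> i; have := congr1 (fun s => nth None s (enum_rank i)) E.
by rewrite !nth_codom enum_rankK.
Qed.

Lemma code_entryP K (Q : finType) : prefix_code (@code_entry K Q).
Proof.
move=> [a b c] [a' b' c'] r s.
by case/(prefix_code_cat (@code_infoP _ _))=> /= -> /(prefix_code_cat code_natP)[-> /code_natP[->]].
Qed.

Lemma code_label_inj K (Q : finType) : injective (@code_label K Q).
Proof.
move=> [a b c d] [a' b' c' d'] E; have := congr1 (fun x => x ++ [::]) E.
case/(prefix_code_cat (@code_infoP _ _))=> /= ->.
do 2!case/(prefix_code_cat code_natP)=> ->.
by case/(code_seqP (@code_entryP K Q))=> ->.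
Qed.

(** The bound on stored vertices is strict because [code_opt] shifts them by one. *)
Definition info_le K Q n (I : info K Q) :=
  [/\ i_id I <= n, i_par I <= n, i_dep I <= n & forall a u, i_S I a = Some u -> u < n].

Definition label_le K Q n k (L : label K Q) :=
  [/\ info_le n (l_inf L), l_root L <= n, l_dist L <= n, size (l_ents L) <= k &
      forall e, List.In e (l_ents L) -> [/\ info_le n (e_inf e), e_pos e <= n & e_rem e <= n]].

Lemma size_code_label K (Q : finType) k : exists c, forall n (L : label K Q),
  label_le n k L -> size (code_label L) <= c * (trunc_log 2 n).+1.
Proof.
pose C := 3 * (trunc_log 2 #|{: 'I_K * {set 'I_K} * Q}|).+1.
(* In units of [(trunc_log 2 n).+1]: three numbers at 3 each, the finite part [C], [K] optional
   identifiers at 3 plus a continuation bit, and the bit ending the list. *)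
pose ci := 9 + C + K * 4 + 1.
have Hi n (I : info K Q) : info_le n I -> size (code_info I) <= ci * (trunc_log 2 n).+1.
  case=> /size_code_nat h1 /size_code_nat h2 /size_code_nat h3 h4.
  rewrite /code_info 4!size_cat.
  have := size_code_fin (i_col I, i_N I, i_st I); rewrite -/C => h5.
  have := @size_code_seq _ code_opt (codom (i_S I)) (3 * (trunc_log 2 n).+1).
  rewrite size_codom card_ord => h6.
  have {}h6 : size (code_seq code_opt (codom (i_S I))) <= K * (3 * (trunc_log 2 n).+1).+1 + 1.
    apply: h6 => x; rewrite /codom /image_mem => /List.in_map_iff[a [<- _]].
    apply: size_code_nat; case E: (i_S I a) => [u|] //; exact: h4 E.
  rewrite /ci; move: h1 h2 h3 h6; move: (trunc_log 2 n).+1 (ltn0Sn (trunc_log 2 n)) => B B0.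
  have := leq_pmulr C B0; have := leq_pmulr K B0; lia.
(* Each 6 pays for two further numbers, in the label and in every entry; an entry also has a
   continuation bit, and the last 1 ends the list. *)
exists (ci + 6 + k * (ci + 6 + 1) + 1) => n L [/Hi h1 /size_code_nat h0 /size_code_nat h2 h3 h4].
rewrite /code_label 3!size_cat.
have := @size_code_seq _ (@code_entry K Q) (l_ents L) ((ci + 6) * (trunc_log 2 n).+1).
have E e : List.In e (l_ents L) -> size (code_entry e) <= (ci + 6) * (trunc_log 2 n).+1.
  by case/h4=> /Hi e1 /size_code_nat e2 /size_code_nat e3; rewrite /code_entry 2!size_cat; nia.
move=> /(_ E); move: h0 h1 h2.
move: (trunc_log 2 n).+1 (ltn0Sn (trunc_log 2 n)) => B B0 h0 h1 h2.
set m := (_ * B).+1 => h5; have mB : m <= (ci + 6 + 1) * B by rewrite /m; lia.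
have := leq_mul h3 mB; rewrite mulnA; lia.
Qed.

(** * The verifier *)

(* [models] interprets every first-order variable by the vertex 0 and every set
   variable by the empty set. *)
Definition info_letter K Q (I : info K Q) : letter K :=
  ((i_col I, i_N I), fun=> 0 == i_id I, fun=> false).

(* [R j L] means that the vertex [j] is a neighbour and carries the label [L]. *)
Definition child_msg K Q (R : nat -> label K Q -> Prop) i (I : info K Q) :=
  [/\ i_par I = i, 0 < i_dep I &
      (exists j L, R j L /\ l_inf L = I) \/
      (exists j L e, [/\ R j L, List.In e (l_ents L), e_rem e = 0 & e_inf e = I])].

(** The fields up to [ac_N] concern connectivity, the root and the colour maps, [ac_root] including
    acceptance by the automaton. Those from [ac_par] to [ac_bwd] govern the copies travelling along
    paths. [ac_ch] compares a vertex with its children, for the inheritance of colour maps and for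
    the state. *)
Record accepts K (Q : Type) (q0 : Q) (delta : letter K -> Q -> Q -> Q) (F : pred Q) k
    (R : nat -> label K Q -> Prop) (i : nat) (L : label K Q) : Prop := Accepts {
  ac_id : i_id (l_inf L) = i;
  ac_dist : i != 0 -> exists j L', R j L' /\ l_dist L = (l_dist L').+1;
  ac_same_root j L' : R j L' -> l_root L' = l_root L;
  ac_root : i_dep (l_inf L) = 0 ->
    [/\ l_root L = i, i_par (l_inf L) = i,
        forall a, a != i_col (l_inf L) -> i_S (l_inf L) a = None &
        F (delta (info_letter (l_inf L)) (i_st (l_inf L)) q0)];
  ac_self : i_S (l_inf L) (i_col (l_inf L)) = Some i;
  ac_nbr j L' : R j L' -> i_dep (l_inf L') <> i_dep (l_inf L) /\
    (i_dep (l_inf L') < i_dep (l_inf L) ->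
     i_S (l_inf L) (i_col (l_inf L')) = Some j);
  ac_N a : a \in i_N (l_inf L) <-> exists j L', R j L' /\ i_S (l_inf L) a = Some j;
  ac_par : 0 < i_dep (l_inf L) -> (exists L', R (i_par (l_inf L)) L') \/
    (exists e, [/\ List.In e (l_ents L), e_inf e = l_inf L & e_pos e = 0]);
  ac_size : size (l_ents L) <= k;
  ac_one e e' : List.In e (l_ents L) -> List.In e' (l_ents L) ->
    i_id (e_inf e) = i_id (e_inf e') -> e = e';
  ac_target e : List.In e (l_ents L) -> i_par (e_inf e) <> i;
  ac_fwd e : List.In e (l_ents L) ->
    if e_rem e is m.+1 then exists j L' e', [/\ R j L', List.In e' (l_ents L'),
      e_inf e' = e_inf e, e_pos e' = (e_pos e).+1 & e_rem e' = m]
    else exists L', R (i_par (e_inf e)) L';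
  ac_bwd e : List.In e (l_ents L) ->
    if e_pos e is m.+1 then exists j L' e', [/\ R j L', List.In e' (l_ents L'),
      e_inf e' = e_inf e & e_pos e' = m]
    else e_inf e = l_inf L;
  ac_ch : exists s : seq (info K Q),
    [/\ forall I, List.In I s <-> child_msg R i I, uniq (map (@i_id K Q) s),
        forall I, List.In I s -> i_dep I = (i_dep (l_inf L)).+1 /\
          (forall a u, a != i_col I -> i_S I a = Some u -> i_S (l_inf L) a = Some u) &
        i_st (l_inf L) = foldr (fun I q => delta (info_letter I) (i_st I) q) q0 s] }.

Definition nbr_label n (G : graph n) K Q (X : 'I_n.+1 -> label K Q) v j L :=
  exists w, [/\ adj G v w, j = val w & L = X w].

Lemma connected_component n (G : graph n) x : connectedG G -> component G x = [set: _].
Proof. by move=> H; apply/setP=> y; rewrite !inE H. Qed.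

(** * Soundness of the verifier *)

Section Soundness.
Variables (n K : nat) (Q : finType) (q0 : Q) (delta : letter K -> Q -> Q -> Q).
Variables (F : pred Q) (k : nat) (G : graph n) (X : 'I_n.+1 -> label K Q).
Hypothesis AC : forall v, accepts q0 delta F k (nbr_label G X v) v (X v).
Let inf v := l_inf (X v).
Let d v := i_dep (inf v).
Let col v := i_col (inf v).
(** Labels are arbitrary, so [inord] might fall back to its default value; [sound_par_val] excludes
    this. *)
Let par v : 'I_n.+1 := inord (i_par (inf v)).
Let S v a : option 'I_n.+1 := obind insub (i_S (inf v) a).

Lemma sound_connected : connectedG G.
Proof.
have H v : connect (adj G) v ord0.
  move: {2}(l_dist (X v)) (leqnn (l_dist (X v))) => m.
  elim: m v => [|m IH] v le; case: (eqVneq v ord0) => [->|ne]; try exact: connect0.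
    by have [|_ [_ [[w [vw _ ->]] e]]] := ac_dist (AC v); [exact: ne|rewrite e in le].
  have [|_ [_ [[w [vw _ ->]] e]]] := ac_dist (AC v); first exact: ne.
  by apply: connect_trans (connect1 vw) (IH w _); lia.
move=> x y; apply: connect_trans (H x) _.
by rewrite (sym_connect_sym (@adj_sym _ G)) H.
Qed.

Lemma sound_id v : i_id (inf v) = v.
Proof. exact: ac_id (AC v). Qed.

(** Positions decrease backwards along copies, and at position 0 the copy must be the holder's own
    information; hence no copy is forged. *)
Lemma sound_source v e : List.In e (l_ents (X v)) -> exists c, e_inf e = inf c.
Proof.
move: {2}(e_pos e) (erefl (e_pos e)) => m; elim: m v e => [|m IH] v e ep ve.
  by exists v; have := ac_bwd (AC v) ve; rewrite ep.
have := ac_bwd (AC v) ve; rewrite ep => -[_ [_ [e' [[w [vw _ ->]] we' <- ep']]]].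
exact: IH we'.
Qed.

Lemma sound_arrive v e : List.In e (l_ents (X v)) -> exists z e' p,
  [/\ adj G z p, List.In e' (l_ents (X z)), e_inf e' = e_inf e, e_rem e' = 0 &
      val p = i_par (e_inf e)].
Proof.
move: {2}(e_rem e) (erefl (e_rem e)) => m; elim: m v e => [|m IH] v e er ve.
  have := ac_fwd (AC v) ve; rewrite er => -[_ [p [vp ep _]]].
  by exists v, e, p.
have := ac_fwd (AC v) ve; rewrite er => -[_ [_ [e' [[w [vw _ ->]] we' <- _ er']]]].
by case: (IH w e' er' we') => z [e2 [p H]]; exists z, e2, p.
Qed.

(** Positions increase along the copies and a vertex holds at most one copy per identifier, so the
    walk never repeats a vertex; [ac_target] keeps the parent off it until the end. *)
Lemma sound_path v e : List.In e (l_ents (X v)) -> exists s p,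
  [/\ path (adj G) v (rcons s p), uniq (v :: rcons s p), val p = i_par (e_inf e) &
      forall z, z \in v :: s -> exists e', [/\ List.In e' (l_ents (X z)),
         e_inf e' = e_inf e & e_pos e <= e_pos e']].
Proof.
move: {2}(e_rem e) (erefl (e_rem e)) => m; elim: m v e => [|m IH] v e er ve.
  have := ac_fwd (AC v) ve; rewrite er => -[_ [p [vp ep _]]].
  exists [::], p; split=> //=; first by rewrite vp.
    rewrite inE andbT; apply/eqP => vep; apply: (ac_target (AC v) ve).
    by rewrite ep vep.
  by move=> z; rewrite inE => /eqP->; exists e.
have := ac_fwd (AC v) ve; rewrite er => -[_ [_ [e' [[w [vw _ ->]] we' ei ep' er']]]].
have [s [p [ps us pp H]]] := IH w e' er' we'; rewrite ei in pp.
have H' z : z \in w :: s -> exists e', [/\ List.In e' (l_ents (X z)),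
    e_inf e' = e_inf e & e_pos e < e_pos e'].
  by case/H=> e2 [ze2 ei2 le]; exists e2; rewrite ei2 ei; split=> //; lia.
exists (w :: s), p; split=> //=.
- by rewrite vw.
- apply/andP; split; last exact: us.
  rewrite -rcons_cons mem_rcons inE negb_or; apply/andP; split.
    by apply/eqP => vep; apply: (ac_target (AC v) ve); rewrite -pp vep.
  apply/negP => /H'[e2 [ze2 ei2]].
  by rewrite (ac_one (AC v) ze2 ve) ?ltnn // ei2.
move=> z; rewrite inE => /orP[/eqP->|/H'[e2 [h1 h2 /ltnW h3]]]; first by exists e.
by exists e2.
Qed.

Lemma sound_parent c : 0 < d c -> exists2 p, val p = i_par (inf c) &
  child_msg (nbr_label G X p) p (inf c).
Proof.
move=> dc; case: (ac_par (AC c) dc) => [[_ [p [cp ep _]]]|[e [ce ei _]]].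
  exists p => //; split=> //; left; exists (val c), (X c); split=> //.
  by exists c; rewrite adj_sym.
have [z [e' [p [zp ze' ei' er' pp]]]] := sound_arrive ce.
rewrite ei in ei' pp; exists p => //; split=> //; right; exists (val z), (X z), e'.
by split=> //; exists z; rewrite adj_sym.
Qed.

Lemma sound_par_val c : val (par c) = i_par (inf c).
Proof.
rewrite /par /= inordK //; case: (posnP (d c)) => [/(ac_root (AC c))[_ -> _ _]|].
  exact: ltn_ord.
by case/sound_parent=> p <- _; apply: ltn_ord.
Qed.

(** No message is forged by [sound_source], and none is missing by [sound_parent]. *)
Lemma sound_child_msg p I : child_msg (nbr_label G X p) p I <->
  exists c, [/\ I = inf c, 0 < d c & par c = p].
Proof.
split.
  case=> ip dI H; have [c Ic] : exists c, I = inf c.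
    case: H => [[_ [_ [[w [_ _ ->]] <-]]]|]; first by exists w.
    by case=> _ [_ [e [[w [_ _ ->]] /sound_source[c ->] _ <-]]]; exists c.
  subst I; exists c; split=> //; apply/val_inj; rewrite /= -ip; exact: sound_par_val.
case=> c [-> dc <-]; have [p' pc H] := sound_parent dc.
by have -> : par c = p' by apply/val_inj; rewrite sound_par_val.
Qed.

Lemma sound_children : exists2 ch, children par d ch & forall p,
  (forall c, c \in ch p -> d c = (d p).+1 /\
    (forall a u, a != col c -> i_S (inf c) a = Some u -> i_S (inf p) a = Some u)) /\
  i_st (inf p) =
    foldr (fun c q => delta (info_letter (inf c)) (i_st (inf c)) q) q0 (ch p).
Proof.
have /choice[ch H] : forall p, exists ch : seq 'I_n.+1, [/\ uniq ch,
    forall c, (c \in ch) = (0 < d c) && (par c == p),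
    forall c, c \in ch -> d c = (d p).+1 /\
    (forall a u, a != col c -> i_S (inf c) a = Some u -> i_S (inf p) a = Some u) &
  i_st (inf p) = foldr (fun c q => delta (info_letter (inf c)) (i_st (inf c)) q) q0 ch].
  move=> p; have [s [sP us sD sQ]] := ac_ch (AC p).
  (* The accepted messages are genuine, so their list, in the order used by the automaton, comes
     from a list of vertices. *)
  have [ch es] : exists ch, s = map inf ch.
    have: forall I, List.In I s -> exists c, I = inf c.
      by move=> I /sP/sound_child_msg[c [-> _ _]]; exists c.
    elim: (s) => [|I t IH] H; first by exists [::].
    case: (H I (or_introl erefl)) => c ->; case: IH => [J Jt|t' ->].
      by apply: H; right.
    by exists (c :: t').
  subst s; have inP c : c \in ch <-> List.In (inf c) (map inf ch).
    split; first by elim: (ch) => //= x t IH; rewrite inE => /orP[/eqP->|/IH]; [left|right].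
    elim: (ch) => //= x t IH []; rewrite inE; last by move/IH->; rewrite orbT.
    by move/(congr1 (@i_id K Q)); rewrite !sound_id => /val_inj->; rewrite eqxx.
  exists ch; split.
  - rewrite -map_comp in us; rewrite -(map_inj_uniq val_inj).
    by rewrite -(eq_map (f := @i_id K Q \o inf)) // => c /=; rewrite sound_id.
  - move=> c; apply/idP/andP.
      move/inP/sP/sound_child_msg=> [c' [/(congr1 (@i_id K Q))]].
      by rewrite !sound_id => /val_inj<- -> ->.
    by case=> dc /eqP pc; apply/inP/sP/sound_child_msg; exists c.
  - by move=> c /inP/sD.
  - by rewrite sQ foldr_map.
exists ch; first by split=> [p|p c]; have [u m _ _] := H p.
by move=> p; have [_ _ h1 h2] := H p.
Qed.

Lemma sound_root_eq u v : l_root (X u) = l_root (X v).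
Proof.
have /connectP[p] := sound_connected u v.
elim: p u => [|w p IH] u /=; first by move=> _ ->.
case/andP=> uw /IH H /H <-; symmetry.
by apply: (ac_same_root (AC u)); exists w.
Qed.

Lemma sound_elim_model : exists r, elim_model G par d r col S.
Proof.
have [ch [uch chP] chD] := sound_children.
have dpar v : d (par v) = (d v).-1.
  case: (posnP (d v)) => [v0|vp].
    have [_ pv _ _] := ac_root (AC v) v0.
    by have -> : par v = v; [apply/val_inj; rewrite sound_par_val|rewrite v0].
  have [|h _] := (chD (par v)).1 v; first by rewrite chP vp eqxx.
  by rewrite h.
have dit j v : d (iter j par v) = d v - j.
  by elim: j => [|j IH] /=; rewrite ?subn0 // dpar IH; lia.
(* The ancestor of vertex 0 at depth 0. It is the only vertex of depth 0, since each such vertex has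
   the commonly announced root as identifier. *)
pose r := iter (d ord0) par ord0; have r0 : d r = 0 by rewrite dit subnn.
have SP v a u : S v a = Some u <-> i_S (inf v) a = Some (val u).
  rewrite /S; case: (i_S _ _) => [j|] //=; split=> [|[->]]; last exact: valK.
  by case: insubP => // w _ <- [->].
exists r; split=> //.
- move=> v; split=> [v0|->//]; apply/val_inj.
  have [h1 _ _ _] := ac_root (AC v) v0; have [h2 _ _ _] := ac_root (AC r) r0.
  exact: etrans (esym h1) (etrans (sound_root_eq v r) h2).
- by move=> v; apply/SP; apply: ac_self (AC v).
- move=> a u /SP; have [_ _ H _] := ac_root (AC r) r0.
  by case: (eqVneq a (col r)) => // /H; rewrite /inf => ->.
- move=> u v uv; have [|h _] := @ac_nbr _ _ _ _ _ _ _ _ _ (AC u) v (X v).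
    by exists v.
  by apply/eqP => e; apply: h.
- move=> u v uv lt; apply/SP.
  have [|_ h] := @ac_nbr _ _ _ _ _ _ _ _ _ (AC v) u (X u); last exact: h.
  by exists u; rewrite adj_sym.
- move=> v a u vp ne /SP Sv; apply/SP.
  have [|_ h] := (chD (par v)).1 v; first by rewrite chP vp eqxx.
  exact: h Sv.
Qed.

Lemma sound_nbr_cols v : nbr_cols G S v = i_N (inf v).
Proof.
apply/setP=> a; rewrite inE; apply/idP/idP.
  rewrite /S /inf; case E: (i_S _ a) => [j|] //=; case: insubP => // u _ uj vu.
  by apply/(ac_N (AC v)); exists (val u), (X u); rewrite E uj; split=> //; exists u.
case/(ac_N (AC v))=> _ [_ [[w [vw -> _]]]]; rewrite /S /inf => -> /=.
by rewrite valK.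
Qed.

Lemma sound_models (Lang : btree (letter K) -> Prop) psi :
  (forall t, Lang t <-> F (brun q0 delta t)) ->
  (forall t l, tree_model G t l -> forall e1 e2,
     mso_holds G e1 e2 psi <-> Lang (bmap (val_letter l e1 e2) t)) ->
  models G psi.
Proof.
move=> LP H; have [r EM] := sound_elim_model; have [ch CH chD] := sound_children.
apply/(H _ _ (em_tree_model EM CH)); apply/LP; rewrite brun_map.
have E v : val_letter (fun v => (col v, nbr_cols G S v)) (fun=> ord0) (fun=> set0) v
  = info_letter (inf v).
  rewrite /val_letter /info_letter sound_nbr_cols; congr (_, _, _); apply/funext=> i.
    by rewrite sound_id.
  by rewrite inE.
rewrite (em_brun EM CH (st := fun v => i_st (inf v))); last first.
  by move=> v; rewrite (chD v).2; elim: (ch v) => //= c s ->; rewrite E.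
have r0 : i_dep (inf r) = 0 by apply/(em_root EM).
by have [_ _ _] := ac_root (AC r) r0; rewrite E.
Qed.

Lemma sound_lvtw : K = k.+1 -> lvtw_le G k%:Z.
Proof.
move=> eK x; have [r EM] := sound_elim_model.
have /choice[f fP] : forall c, exists s : seq 'I_n.+1, 0 < d c -> ~~ adj G c (par c) ->
    is_opath G (rcons (c :: s) (par c)) /\
    forall z, z \in c :: s -> exists2 e, List.In e (l_ents (X z)) & e_inf e = inf c.
  move=> c; case: (pselect (0 < d c)) => [dc|]; last by exists [::].
  case: (boolP (adj G c (par c))) => [|nc]; first by exists [::].
  case: (ac_par (AC c) dc) => [[_ [p [cp ep _]]]|[e [ce ei _]]].
    have E : par c = p by apply/val_inj; rewrite sound_par_val.
    by rewrite E cp in nc.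
  have [s [p [ps us pp H]]] := sound_path ce; rewrite ei in pp.
  have E : par c = p by apply/val_inj; rewrite sound_par_val.
  exists s => _ _; rewrite E; split; first by apply/andP.
  by move=> z /H[e' [h1 h2 _]]; exists e'; rewrite ?h2.
pose cs := [seq c <- enum 'I_n.+1 | (0 < d c) && ~~ adj G c (par c)].
have csP c : c \in cs -> 0 < d c /\ ~~ adj G c (par c).
  by rewrite mem_filter => /andP[/andP[]].
have ucs : uniq cs by rewrite filter_uniq ?enum_uniq.
pose P c := rcons (c :: f c) (par c).
exists par, r, [seq P c | c <- cs]; rewrite connected_component; last exact: sound_connected.
split.
- exact: (em_elim_tree EM).
- by move=> v _; have := card_em_str EM [set: _] v; rewrite eK; lia.
- apply/andP; split.
    by apply/allP=> _ /mapP[c /csP[dc nc] ->]; have [] := fP c dc nc.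
  by rewrite map_inj_uniq // => c c' [].
- move=> v; rewrite /congestion_at count_map lez_nat.
  (* Paths counted at [v] have distinct starts, and each leaves at [v] an entry with the identifier
     of its start; so they are no more than the entries. *)
  apply: leq_trans (ac_size (AC v)); rewrite -size_filter.
  rewrite -(size_map val) -(size_map (fun e => i_id (e_inf e)) (l_ents (X v))).
  apply: uniq_leq_size; first by rewrite (map_inj_uniq val_inj) filter_uniq.
  move=> y /mapP[c]; rewrite mem_filter => /andP[/= /andP[vP hl] /csP[dc nc]] ->{y}.
  have [_ H] := fP c dc nc.
  have [|e ve ei] := H v.
    (* The final vertex of a path holds no copy, but congestion does not count it either. *)
    move: vP; rewrite mem_rcons inE => /orP[/eqP vp|//]; move: hl.
    by rewrite last_rcons vp eqxx orbF /= => /eqP->; rewrite mem_head.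
  rewrite -sound_id -ei; elim: (l_ents _) ve => //= e' t IH [->|/IH]; rewrite inE ?eqxx //.
  by move->; rewrite orbT.
move=> v _ vr; case: (boolP (adj G v (par v))) => [|nv]; [by left|right].
exists (f v); apply/mapP; exists v => //; rewrite mem_filter nv mem_enum !andbT.
by rewrite lt0n; apply: contra vr => /eqP/(em_root EM)->.
Qed.
End Soundness.

(** * The prover *)

Lemma ranked_exists n (par : 'I_n.+1 -> 'I_n.+1) r :
  par r = r -> (forall v, anc par r v) ->
  exists2 d, ranked par d r & forall v, d v <= n.
Proof.
move=> pr ar; have ex v : exists j, iter j par v == r.
  by exists (findex par v r); rewrite (iter_findex (ar v)).
pose d v := ex_minn (ex v).
have dP v : iter (d v) par v = r by rewrite /d; case: ex_minnP => m /eqP.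
have dmin v j : iter j par v = r -> d v <= j.
  by rewrite /d; case: ex_minnP => m _ H e; apply: H; rewrite e.
have d0 v : d v = 0 <-> v = r.
  by split=> [e|->]; [have := dP v; rewrite e|apply/eqP; rewrite -leqn0 dmin].
exists d; first split=> // v.
  case E: (d v) => [|m] /=; first by move/d0: E => ->; rewrite pr; apply/d0.
  apply/eqP; rewrite eqn_leq; apply/andP; split.
    by apply: dmin; rewrite -iterSr -E.
  by rewrite -ltnS -E; apply: dmin; rewrite iterSr.
move=> v; apply: leq_trans (dmin _ _ (iter_findex (ar v))) _.
rewrite -ltnS; apply: leq_trans (findex_max (ar v)) _.
by apply: leq_trans (max_card _) _; rewrite card_ord.
Qed.

Lemma dist_exists n (G : graph n) : connectedG G -> exists dist : 'I_n.+1 -> nat,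
  (forall v, v != ord0 -> exists2 w, adj G v w & dist v = (dist w).+1) /\
  forall v, dist v <= n.
Proof.
move=> cG.
have ex v : exists j, `[< exists p, [/\ path (adj G) v p, last v p = ord0 & size p = j] >].
  by have /connectP[p vp lp] := cG v ord0; exists (size p); apply/asboolP; exists p.
pose dist v := ex_minn (ex v).
have dP v : exists p, [/\ path (adj G) v p, last v p = ord0 & size p = dist v].
  by rewrite /dist; case: ex_minnP => m /asboolP.
have dmin v p : path (adj G) v p -> last v p = ord0 -> dist v <= size p.
  by rewrite /dist; case: ex_minnP => m _ H h1 h2; apply: H; apply/asboolP; exists p.
exists dist; split=> v.
  move=> v0; have [[|w p] [/= vp lp sp]] := dP v; first by rewrite lp eqxx in v0.
  case/andP: vp => vw wp; exists w => //; apply/eqP; rewrite eqn_leq.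
  rewrite -{2}sp ltnS dmin // andbT.
  have [p' [wp' lp' <-]] := dP w; have := @dmin v (w :: p').
  by rewrite /= vw; apply.
have /connectP[p vp lp] := cG v ord0.
case/shortenP: vp lp => p' vp' up' _ lp.
apply: leq_trans (dmin _ _ vp' (esym lp)) _.
by have := max_card (mem (v :: p')); rewrite (card_uniqP up') card_ord.
Qed.

(** * Colouring an elimination tree of bounded width *)

Section Colouring.
Variables (n k : nat) (G : graph n) (par : 'I_n.+1 -> 'I_n.+1) (d : 'I_n.+1 -> nat).
Variable r : 'I_n.+1.
Hypothesis RK : ranked par d r.
Hypothesis ET : forall u v, adj G u v -> anc par u v || anc par v u.
Let T := [set: 'I_n.+1].
Hypothesis W : forall v, #|str G T par v| <= k.+1.

Lemma anc_trans u v w : anc par u v -> anc par v w -> anc par u w.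
Proof. by rewrite /anc => uv vw; apply: connect_trans vw uv. Qed.

Lemma strP u v : u \in str G T par v <->
  u = v \/ [/\ u != v, anc par u v & exists2 w, anc par v w & adj G u w].
Proof.
rewrite inE; split.
  case/orP=> [/eqP|/and3P[uv a /exists_inP[w]]]; first by left.
  by rewrite !inE /= => vw uw; right; split=> //; exists w.
case=> [->|[uv a [w vw uw]]]; first by rewrite eqxx.
rewrite uv a /= (_ : [exists _ in _, _] = true) ?orbT //.
by apply/exists_inP; exists w => //; rewrite !inE.
Qed.

(** Colours are chosen by increasing depth: besides [v], the set [str v] has at most [k] vertices,
    all strict ancestors, so one of [k.+1] colours is free. *)
Lemma greedy_colouring : exists col : 'I_n.+1 -> 'I_k.+1,
  forall v u, u \in str G T par v -> u != v -> col u != col v.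
Proof.
suff H m : exists col : 'I_n.+1 -> 'I_k.+1,
    forall v, d v < m -> forall u, u \in str G T par v -> u != v -> col u != col v.
  have [col H'] := H (\max_v d v).+1; exists col => v; apply: H'.
  by rewrite ltnS; apply: leq_bigmax.
elim: m => [|m [col IH]]; first by exists (fun=> ord0).
have /choice[g gP] : forall v, exists a, a \notin [set col u | u in str G T par v :\ v].
  move=> v; apply/existsP; apply: contraT; rewrite negb_exists => /forallP H.
  have: #|'I_k.+1| <= #|[set col u | u in str G T par v :\ v]|.
    by apply/subset_leq_card/subsetP=> a _; have := H a; rewrite negbK.
  rewrite card_ord => /leq_trans/(_ (leq_imset_card _ _)).
  have vs : v \in str G T par v by apply/strP; left.
  by have := W v; rewrite (cardsD1 v) vs add1n ltnS => h /leq_trans/(_ h); rewrite ltnn.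
exists (fun v => if d v == m then g v else col v) => v; rewrite ltnS => vm u us uv.
have uv' : d u < d v.
  by case/strP: us => [e|[_ a _]]; [rewrite e eqxx in uv|apply: (rk_anc_lt RK)].
have -> /= : (d u == m) = false by lia.
case: (d v =P m) => [e|ne]; last by apply: IH => //; lia.
by apply: contraNneq (gP v) => <-; apply: imset_f; rewrite in_setD1 uv.
Qed.

(** Greedy colours are injective on all of [str v]: two of its vertices are comparable, and the
    upper one lies in [str] of the lower one, having a neighbour below it. *)
Lemma elim_model_exists : exists col S, @elim_model n k.+1 G par d r col S.
Proof.
have [col colP] := greedy_colouring.
have lt u v : anc par u v -> u != v -> d u < d v by apply: (rk_anc_lt RK).
have cmp u u' v : anc par u v -> anc par u' v -> d u' <= d u -> anc par u' u.
  move=> /iter_findex <- /iter_findex <-; set i := findex par v u; set j := findex par v u'.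
  move=> le; case: (leqP i j) => ij.
    have -> : iter j par v = iter (j - i) par (iter i par v) by rewrite -iterD subnK.
    exact: fconnect_iter.
  case: (eqVneq (iter i par v) (iter j par v)) => [->|ne]; first exact: connect0.
  have e : iter i par v = iter (i - j) par (iter j par v) by rewrite -iterD subnK // ltnW.
  have a : anc par (iter i par v) (iter j par v) by rewrite e; apply: fconnect_iter.
  by have := lt _ _ a ne; rewrite ltnNge le.
have anc_str u v : u \in str G T par v -> anc par u v.
  by case/strP=> [->|[_ ? _]//]; apply: connect0.
have inj0 v u u' : u \in str G T par v -> u' \in str G T par v -> d u' <= d u ->
    col u = col u' -> u = u'.
  move=> us us' le e; apply/eqP; apply: contraT => ne.
  have a : anc par u' u := cmp _ _ _ (anc_str _ _ us) (anc_str _ _ us') le.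
  suff /colP : u' \in str G T par u by rewrite eq_sym ne e eqxx => /(_ isT).
  apply/strP; right; split=> //; first by rewrite eq_sym.
  case/strP: us' => [e'|[_ _ [w vw uw]]].
    by rewrite e' in le ne; have := lt _ _ (anc_str _ _ us) ne; lia.
  by exists w => //; apply: anc_trans vw; apply: anc_str.
have inj v u u' : u \in str G T par v -> u' \in str G T par v -> col u = col u' -> u = u'.
  move=> us us' e; case: (leqP (d u') (d u)) => [le|/ltnW le]; first exact: (inj0 v).
  by symmetry; apply: (inj0 v).
pose S v a := [pick u in str G T par v | col u == a].
have SP v a u : S v a = Some u <-> u \in str G T par v /\ col u = a.
  rewrite /S; case: pickP => [w /andP[ws /eqP wa]|H]; split=> //.
  - by case=> <-.
  - by case=> us ua; congr Some; apply: (inj v) => //; rewrite ua.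
  - by case=> us /eqP ua; have := H u; rewrite us ua.
exists col, S; split.
- exact: RK.1.
- exact: RK.2.
- by move=> v; apply/SP; split=> //; apply/strP; left.
- move=> a u /SP[us <-]; case/strP: us => [->//|[ne /lt/(_ ne)]].
  by rewrite ((RK.1 r).2 erefl).
- move=> u v uv; have ne : u != v by apply: contraTneq uv => ->; rewrite adj_irr.
  by case/orP: (ET uv) => /lt; rewrite ?ne 1?eq_sym ?ne => /(_ isT); lia.
- move=> u v uv le; apply/SP; split=> //; apply/strP; right.
  have ne : u != v by apply: contraTneq uv => ->; rewrite adj_irr.
  split=> //; last by exists v => //; apply: connect0.
  case/orP: (ET uv) => // /lt; rewrite eq_sym ne => /(_ isT); lia.
- move=> v a u vp ne /SP[us ua]; apply/SP; split=> //.
  case/strP: us => [e|[uv a' [w vw uw]]]; first by rewrite -ua e eqxx in ne.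
  have ap : anc par u (par v).
    move: a' uv => /iter_findex; case: (findex _ _ _) => [<-|j]; first by rewrite eqxx.
    by rewrite iterSr => <- _; apply: fconnect_iter.
  apply/strP; case: (eqVneq u (par v)) => [->|up]; [by left|right].
  split=> //; exists w => //; apply: anc_trans vw.
  exact: (fconnect_iter par 1).
Qed.
End Colouring.

Lemma In_map (T : eqType) U (g : T -> U) s x :
  List.In x (map g s) <-> exists2 c, c \in s & x = g c.
Proof.
elim: s x => [|a s IH] x /=; first by split=> // -[].
split=> [[<-|/IH[c cs ->]]|[c]]; first by exists a; rewrite ?mem_head.
  by exists c => //; rewrite inE cs orbT.
by rewrite inE => /orP[/eqP->|cs] ->; [left|right; apply/IH; exists c].
Qed.

(** * Completeness: honest labels are accepted *)

Section Completeness.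
Variables (n k : nat) (Q : finType) (q0 : Q) (delta : letter k.+1 -> Q -> Q -> Q).
Variables (F : pred Q) (G : graph n) (par : 'I_n.+1 -> 'I_n.+1) (d : 'I_n.+1 -> nat).
Variables (r : 'I_n.+1) (col : 'I_n.+1 -> 'I_k.+1) (S : 'I_n.+1 -> 'I_k.+1 -> option 'I_n.+1).
Variables (ps : seq (seq 'I_n.+1)) (dist : 'I_n.+1 -> nat) (st : 'I_n.+1 -> Q).
Variable f : 'I_n.+1 -> seq 'I_n.+1.
Hypothesis EM : elim_model G par d r col S.
Hypothesis dn : forall v, d v <= n.
Hypothesis distP : forall v, v != ord0 -> exists2 w, adj G v w & dist v = (dist w).+1.
Hypothesis distn : forall v, dist v <= n.
Hypothesis psP : opath_system G ps.
Hypothesis psk : forall v, congestion_at ps v <= k.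
Hypothesis fP : forall c, 0 < d c -> ~~ adj G c (par c) -> rcons (c :: f c) (par c) \in ps.

Definition honest_ch v := [seq c <- enum 'I_n.+1 | (0 < d c) && (par c == v)].
Let ch := honest_ch.

Definition honest_inf (v : 'I_n.+1) : info k.+1 Q :=
  Info v (par v) (d v) (col v) [ffun a => omap val (S v a)] (nbr_cols G S v) (st v).
Let inf := honest_inf.

Let cs := [seq c <- enum 'I_n.+1 | (0 < d c) && ~~ adj G c (par c)].

Definition honest_entry z c : entry k.+1 Q :=
  Entry (inf c) (index z (c :: f c)) (size (f c) - index z (c :: f c)).

Definition honest_label (v : 'I_n.+1) : label k.+1 Q :=
  Label (inf v) r (dist v) [seq honest_entry v c | c <- cs & v \in c :: f c].
Let X := honest_label.

Lemma honest_rem z c : e_rem (honest_entry z c) = size (f c) - index z (c :: f c).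
Proof. by []. Qed.

Lemma honest_pos z c : e_pos (honest_entry z c) = index z (c :: f c).
Proof. by []. Qed.

Lemma honest_children : children par d ch.
Proof.
split=> [p|p c]; first by rewrite filter_uniq ?enum_uniq.
by rewrite mem_filter mem_enum andbT.
Qed.

Lemma mem_cs c : (c \in cs) = (0 < d c) && ~~ adj G c (par c).
Proof. by rewrite mem_filter mem_enum andbT. Qed.

Lemma cs_ps c : c \in cs -> rcons (c :: f c) (par c) \in ps.
Proof. by rewrite mem_cs => /andP[dc nc]; apply: fP. Qed.

Lemma cs_path c : c \in cs ->
  path (adj G) c (rcons (f c) (par c)) /\ uniq (rcons (c :: f c) (par c)).
Proof.
by move/cs_ps=> cps; have /andP[/allP/(_ _ cps)/andP[]] := psP.
Qed.

Lemma cs_step c i : c \in cs -> i < size (f c) ->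
  adj G (nth c (c :: f c) i) (nth c (c :: f c) i.+1).
Proof.
move=> /cs_path[/(pathP c) + _] lt => /(_ i); rewrite size_rcons ltnS => /(_ (ltnW lt)).
rewrite -rcons_cons !nth_rcons /= lt ltnS (ltnW lt).
by [].
Qed.

Lemma cs_last c : c \in cs -> adj G (nth c (c :: f c) (size (f c))) (par c).
Proof.
move=> /cs_path[/(pathP c) + _] => /(_ (size (f c))); rewrite size_rcons ltnSn => /(_ isT).
by rewrite -rcons_cons !nth_rcons /= ltnSn ltnn eqxx.
Qed.

Lemma cs_uniq c : c \in cs -> uniq (c :: f c).
Proof. by move/cs_path=> [_]; rewrite rcons_uniq => /andP[]. Qed.

Lemma cs_size c : c \in cs -> size (f c) < n.
Proof.
move/cs_path=> [_ /card_uniqP]; rewrite size_rcons /= => e.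
by have := max_card (mem (rcons (c :: f c) (par c))); rewrite e card_ord.
Qed.

Lemma honest_in v e : List.In e (l_ents (X v)) <->
  exists c, [/\ c \in cs, v \in c :: f c & e = honest_entry v c].
Proof.
rewrite In_map; split=> [[c]|[c [cc vc ->]]].
  by rewrite mem_filter => /andP[vc cc] ->; exists c.
by exists c => //; rewrite mem_filter vc.
Qed.

(** Each entry at [v] comes from a path having [v] before its last vertex, and these paths have
    distinct starts; the congestion bound applies. *)
Lemma honest_size v : size (l_ents (X v)) <= k.
Proof.
apply: leq_trans (psk v); rewrite /= size_map /congestion_at -size_filter.
rewrite -(size_map (fun c => rcons (c :: f c) (par c))); apply: uniq_leq_size.
  rewrite map_inj_uniq => [|c c' []//]; apply/filter_uniq/filter_uniq.
  exact: enum_uniq.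
move=> P /mapP[c]; rewrite mem_filter => /andP[vc cc] ->{P}.
rewrite mem_filter cs_ps // andbT mem_rcons inE vc orbT last_rcons /=.
have [_] := cs_path cc; rewrite rcons_uniq => /andP[nc _].
by apply/orP; right; apply: contraNneq nc => <-.
Qed.

Lemma honest_child v I : child_msg (nbr_label G X v) v I <-> List.In I (map inf (ch v)).
Proof.
rewrite In_map; split.
  case=> ip dI H; have [c Ic] : exists c, I = inf c.
    case: H => [[_ [_ [[w [_ _ ->]] <-]]]|]; first by exists w.
    by case=> _ [_ [e [[w [_ _ ->]] /honest_in[c [_ _ ->]] _ <-]]]; exists c.
  subst I; exists c => //; rewrite honest_children.2; apply/andP; split=> //.
  by apply/eqP/val_inj.
case=> c; rewrite honest_children.2 => /andP[dc /eqP pc] ->; split=> //=; first by rewrite pc.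
case: (boolP (adj G c v)) => [cv|nc].
  by left; exists (val c), (X c); split=> //; exists c; rewrite adj_sym.
have cc : c \in cs by rewrite mem_cs dc pc.
(* The last vertex before the parent holds the copy that the parent reads. *)
right; pose z := nth c (c :: f c) (size (f c)).
have zc : z \in c :: f c by apply: mem_nth.
exists (val z), (X z), (honest_entry z c); split=> //.
- by exists z; split=> //; rewrite adj_sym -pc; apply: cs_last.
- by apply/honest_in; exists c.
- by rewrite honest_rem index_uniq ?subnn // cs_uniq.
Qed.

Lemma honest_label_le v : label_le n.+1 k (X v).
Proof.
have Hi c : info_le n.+1 (inf c).
  split=> /=; [exact/ltnW/ltn_ord|exact/ltnW/ltn_ord|exact: leqW|].
  by move=> a u; rewrite ffunE; case: (S c a) => //= w [<-]; apply: ltn_ord.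
split=> //=; [exact/ltnW/ltn_ord|exact: leqW|exact: honest_size|].
move=> e /honest_in[c [cc vc ->]]; split; [exact: Hi| |].
  by rewrite honest_pos; apply: leq_trans (index_size _ _) _; have := cs_size cc => /=; lia.
by have := cs_size cc; rewrite honest_rem; lia.
Qed.

Hypothesis stP : forall v,
  st v = foldr (fun c q => delta (info_letter (inf c)) (st c) q) q0 (ch v).
Hypothesis rF : F (delta (info_letter (inf r)) (st r) q0).

Lemma honest_accepts v : accepts q0 delta F k (nbr_label G X v) v (X v).
Proof.
have pr := rk_par_root (em_ranked EM).
split=> //=.
- by move=> v0; have [w vw e] := distP v0; exists (val w), (X w); split=> //; exists w.
- by move=> j L' [w [_ _ ->]].
- move=> v0; have -> : v = r by apply/(em_root EM).
  split=> //; first by rewrite pr.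
  move=> a ne; rewrite ffunE; case E: (S r a) => [u|] //.
  by rewrite (em_rootS EM E) eqxx in ne.
- by rewrite ffunE (em_self EM).
- move=> j L' [w [vw -> ->]] /=; split.
    by move=> e; have := em_adj EM vw; rewrite e eqxx.
  by rewrite adj_sym in vw => lt; rewrite ffunE (em_nbr EM vw lt).
- move=> a; rewrite inE; split.
    case E: (S v a) => [u|] // vu; exists (val u), (X u); rewrite ffunE E; split=> //.
    by exists u.
  case=> j [L' [[w [vw -> _]]]]; rewrite ffunE; case: (S v a) => //= u [/val_inj e].
  by rewrite e.
- move=> dv; case: (boolP (adj G v (par v))) => [vp|nv].
    by left; exists (X (par v)); exists (par v).
  right; exists (honest_entry v v); split=> //; last by rewrite /= eqxx.
  by apply/honest_in; exists v; rewrite mem_cs dv nv mem_head.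
- exact: honest_size.
- move=> e e' /honest_in[c [_ _ ->]] /honest_in[c' [_ _ ->]] /= /val_inj -> //.
- move=> e /honest_in[c [cc vc ->]] /= pv; have [_] := cs_path cc.
  by rewrite rcons_uniq (val_inj pv) vc.
- move=> e /honest_in[c [cc vc ->]]; rewrite honest_rem honest_pos.
  set i := index v (c :: f c).
  have il : i < size (c :: f c) by rewrite index_mem.
  have iv : nth c (c :: f c) i = v by rewrite nth_index.
  case E: (size (f c) - i) => [|m].
    have si : i = size (f c) by move: il => /=; lia.
    exists (X (par c)), (par c); split=> //; rewrite -iv si; exact: cs_last.
  have il' : i < size (f c) by lia.
  pose w := nth c (c :: f c) i.+1.
  have wi : index w (c :: f c) = i.+1 by rewrite index_uniq ?cs_uniq.
  exists (val w), (X w), (honest_entry w c); split=> //.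
  + by exists w; split=> //; rewrite -iv; apply: cs_step.
  + by apply/honest_in; exists c; split=> //; apply: mem_nth.
  + by rewrite honest_rem wi; lia.
- move=> e /honest_in[c [cc vc ->]]; rewrite honest_pos.
  set i := index v (c :: f c).
  have il : i < size (c :: f c) by rewrite index_mem.
  have iv : nth c (c :: f c) i = v by rewrite nth_index.
  case E: i => [|m]; first by rewrite -iv E.
  pose w := nth c (c :: f c) m; rewrite E in il iv.
  have wi : index w (c :: f c) = m by rewrite index_uniq ?cs_uniq // ltnW.
  exists (val w), (X w), (honest_entry w c); split=> //.
  + by exists w; split=> //; rewrite adj_sym -iv; apply: cs_step.
  + by apply/honest_in; exists c; split=> //; apply: mem_nth; rewrite ltnW.
- exists (map inf (ch v)); split.
  + by move=> I; rewrite honest_child.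
  + rewrite -map_comp (map_inj_uniq (f := @i_id _ _ \o inf)); last exact: val_inj.
    exact: honest_children.1.
  + move=> I /In_map[c]; rewrite honest_children.2 => /andP[dc /eqP pc] -> /=; split.
      by have := em_par EM c; rewrite pc; lia.
    move=> a u ne; rewrite !ffunE; case E: (S c a) => [w|] //= [<-].
    by rewrite -pc (em_up EM dc ne E).
  + by rewrite stP foldr_map.
Qed.

End Completeness.

(** * Assembly of the proof labeling scheme *)

Lemma labelling_exists n k (G : graph n) (Q : finType) (q0 : Q)
    (delta : letter k.+1 -> Q -> Q -> Q) (F : pred Q) (Lang : btree (letter k.+1) -> Prop) psi :
  (forall t, Lang t <-> F (brun q0 delta t)) ->
  (forall t l, tree_model G t l -> forall e1 e2,
     mso_holds G e1 e2 psi <-> Lang (bmap (val_letter l e1 e2) t)) ->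
  connectedG G -> lvtw_le G k%:Z -> models G psi ->
  exists X : 'I_n.+1 -> label k.+1 Q, forall v,
    accepts q0 delta F k (nbr_label G X v) v (X v) /\ label_le n.+1 k (X v).
Proof.
move=> LP HL cG /(_ ord0)[par [r [ps []]]] + + psP psk + mG.
rewrite (connected_component _ cG) => -[_ pr _ ar ET] W wP.
have inT (v : 'I_n.+1) : v \in [set: 'I_n.+1] by rewrite inE.
have [d RK dn] := ranked_exists pr (fun v => ar v (inT v)).
have [dist [distP distn]] := dist_exists cG.
have W' v : #|str G [set: 'I_n.+1] par v| <= k.+1 by have := W v (inT v); lia.
have [col [S EM]] := elim_model_exists RK (fun u v => ET u v (inT u) (inT v)) W'.
have /choice[f fP] : forall c, exists s,
    0 < d c -> ~~ adj G c (par c) -> rcons (c :: s) (par c) \in ps.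
  move=> c; case: (eqVneq c r) => [->|cr].
    by exists [::]; rewrite ((em_root EM r).2 erefl).
  by case: (wP c (inT c) cr) => [ac|[s sP]]; [exists [::]; rewrite ac|exists s].
have CH := honest_children par d.
pose lett v : letter k.+1 := ((col v, nbr_cols G S v), fun=> 0 == val v, fun=> false).
have [st stP] := em_state EM CH q0 (fun v => delta (lett v)).
exists (honest_label G par d r col S dist st f) => v; split; last first.
  exact: (honest_label_le r col S st dn distn psP psk fP).
apply: (honest_accepts (ps := ps)) => //.
have /(HL _ _ (em_tree_model EM CH)) := mG; move/LP; rewrite brun_map.
have -> : (fun v => delta (val_letter (fun v => (col v, nbr_cols G S v))
   (fun=> ord0) (fun=> set0) v)) = fun v => delta (lett v).
  apply/funext=> w; congr delta; rewrite /val_letter /lett; congr (_, _, _).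
  by apply/funext=> i; rewrite inE.
by rewrite (em_brun EM CH stP).
Qed.

Theorem theorem9 (omega : int) (psi : mso) :
  mso_sentence psi ->
  has_log_PLS (fun n (G : graph n) =>
    [/\ connectedG G, lvtw_le G omega & models G psi]).
Proof.
move=> _; case: omega => [k|m]; last first.
  (* For negative [omega] the class is empty, as [str r] contains [r] and the width is at least 0; a
     verifier that always rejects is correct. *)
  have E n (G : graph n) : ~ lvtw_le G (Negz m).
    move=> /(_ ord0)[par [r [ps [[rC _ _ _ _] /(_ r rC) W _ _ _]]]].
    have : 0 < #|str G (component G ord0) par r|.
      by apply/card_gt0P; exists r; rewrite inE eqxx.
    lia.
  exists (fun _ _ _ => [::]), (fun _ _ => false); split.
  - by move=> n G [_ /E].
  - by move=> n G _ lab; exists ord0.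
  - by exists 0 => n G [_ /E].
have [Lang [[Q [q0 [delta [F LP]]]] HL]] := mso_recognizable k.+1 psi.
pose cls n (G : graph n) := [/\ connectedG G, lvtw_le G k%:Z & models G psi].
pose good n (G : graph n) (X : 'I_n.+1 -> label k.+1 Q) := forall v,
    accepts q0 delta F k (nbr_label G X v) v (X v) /\ label_le n.+1 k (X v).
have ex n (G : graph n) : cls n G -> exists X, good n G X.
  by case=> cG lG mG; apply: (labelling_exists LP (HL n G)).
pose Pr n (G : graph n) v : bitseq :=
  if pselect (cls n G) is left c then code_label (sval (cid (ex n G c)) v) else [::].
(* Labels are decoded from the view by injectivity of [code_label], and identifiers are shifted back
   to start from 0. *)
pose R i (vw : seq (nat * bitseq)) j (L : label k.+1 Q) :=
  j != i /\ (j.+1, code_label L) \in vw.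
pose Vf i vw := `[< exists L, (i, code_label L) \in vw /\
  accepts q0 delta F k (R i.-1 vw) i.-1 L >].
have viewP n (G : graph n) lab v j b : (j, b) \in view G lab v <->
    exists w, [/\ (w == v) || adj G v w, j = (val w).+1 & b = lab w].
  split; first by case/mapP=> w; rewrite mem_filter => /andP[vw _] [-> ->]; exists w.
  by case=> w [vw -> ->]; apply/mapP; exists w => //; rewrite mem_filter vw mem_enum.
have RE n (G : graph n) (lab : 'I_n.+1 -> bitseq) X v : (forall w, lab w = code_label (X w)) ->
    R (val v) (view G lab v) = nbr_label G X v.
  move=> labX; apply/funext=> j; apply/funext=> L; apply/propext; split.
    case=> jv /viewP[w [/orP[/eqP wv|vw] [jw] Lw]]; first by rewrite jw wv eqxx in jv.
    by exists w; split=> //; apply: (@code_label_inj k.+1 Q); rewrite Lw labX.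
  case=> w [vw -> ->]; split.
    by apply: contraTneq vw => /val_inj ->; rewrite adj_irr.
  by apply/viewP; exists w; rewrite vw orbT labX.
exists Pr, Vf; split.
- move=> n G c v; apply/asboolP; rewrite /Pr; case: pselect => // c'.
  case: (cid _) => X gX /=; exists (X v); split.
    by apply/viewP; exists v; rewrite eqxx.
  by rewrite (RE n G _ X) //; have [] := gX v.
- move=> n G nc lab; apply: contrapT => H; apply: nc.
  have {}H v : Vf (val v).+1 (view G lab v).
    by apply: contraT => h; exfalso; apply: H; exists v.
  (* Every vertex accepts only if its own bit string is a code, so all labels decode
     simultaneously. *)
  have /choice[X XP] : forall v, exists L, lab v = code_label L /\
      accepts q0 delta F k (R (val v) (view G lab v)) v L.
    move=> v; have /asboolP[L [/viewP[w [_ [/val_inj <-] <-]] ac]] := H v.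
    by exists L.
  have AC v : accepts q0 delta F k (nbr_label G X v) v (X v).
    by have [_] := XP v; rewrite (RE n G lab X) // => w; have [] := XP w.
  split; [exact: sound_connected AC|exact: sound_lvtw AC _|].
  exact: (sound_models AC LP (HL n G)).
have [c cP] := size_code_label k.+1 Q k.
exists c => n G cl v; rewrite /Pr; case: pselect => // c'.
by case: (cid _) => X gX /=; apply: cP; have [] := gX v.
Qed.
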